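(* Let $q$ be a power of a prime $p\ge 3$. The product $m:\mathbf{SC}^D\otimes\mathbf{SC}^D\to\mathbf{SC}^D$ and the coproduct $\Delta:\mathbf{SC}^D\to\mathbf{SC}^D\otimes\mathbf{SC}^D$ that are given in the $P$-basis, by (bi)linear extension, by $$P_{\mu}\cdot P_{\nu}=P_{\mu\sqcup\nu\uparrow^{k}}\qquad(k,l\ge 0,\ \mu\in D_{2k}(q),\ \nu\in D_{2l}(q)),$$ $$\Delta(P_{\lambda})=\sum_{\substack{A\subseteq[n]\\ \lambda=\lambda|_A\sqcup\lambda|_{A^c}}}P_{\mathrm{st}_A(\lambda|_A)}\otimes P_{\mathrm{st}_{A^c}(\lambda|_{A^c})}\qquad(n\ge 0,\ \lambda\in D_{2n}(q)),$$ endow the complex vector space $\mathbf{SC}^D=\bigoplus_{n\ge 0}\mathbf{SC}^D_{2n}$ with a Hopf algebra structure (with unit $\kappa_\emptyset\in\mathbf{SC}^D_0$ and counit $\epsilon$ described in the context).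
   Context: Let $\mathbb F_q$ be a finite field of order $q=p^r$ with $p\ge 3$, and $\mathbb F_q^*$ its nonzero elements. For $n\ge 0$ write $[n]=\{1,\dots,n\}$ and $[\pm n]=\{\pm1,\dots,\pm n\}$, totally ordered by $1\prec\cdots\prec n\prec -n\prec\cdots\prec -1$; rows and columns of $2n\times 2n$ matrices are indexed by $[\pm n]$ in this order. Let $U_{m}(q)$ be the group of unipotent upper triangular $m\times m$ matrices over $\mathbb F_q$. Let $J$ be the $n\times n$ matrix with ones on the antidiagonal and zeros elsewhere. The type $D$ unipotent group is $$U^D_{2n}(q)=\left\{\begin{pmatrix}P&PQ\\0&JP^{-t}J\end{pmatrix}: P\in U_n(q),\ Q\in M_n(q),\ JQ^tJ=-Q\right\}\subseteq U_{2n}(q),$$ where $M_n(q)$ is the set of $n\times n$ matrices over $\mathbb F_q$. Labelled $D$-partitions. A $D_{2n}(q)$-partition $\lambda$ of $[\pm n]$ is a set of labelled arcs $(i,j,a)$ with $i,j\in[\pm n]$, $i\prec j$, $j\ne -i$, $a\in\mathbb F_q^*$ (at most one label for each pair $(i,j)$), such that: (a) if $(i,j,a)\in\lambda$ then $(-j,-i,-a)\in\lambda$; (b) if $(i,j,a)\in\lambda$ and $i\prec k\prec j$, then no arc $(i,k,b)$ and no arc $(k,j,b)$ belongs to $\lambda$. Write $\lambda\in D_{2n}(q)$; the set $D_0(q)$ has the single element $\emptyset$ (empty ground set). The ground set $[\pm n]$ is part of the data. Let $\mathcal A(\lambda)$ denote the set of labelled arcs of $\lambda$. Superclass functions. For $\lambda\in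 D_{2n}(q)$ put $y_\lambda=\sum_{(i,j,a)\in\lambda}a\,e_{i,j}$, where $e_{i,j}$ is the matrix unit, $V_\lambda=U_{2n}(q)\,y_\lambda\,U_{2n}(q)$, and let $K_\lambda=U^D_{2n}(q)\cap(V_\lambda+I_{2n})$ be the superclass of $\lambda$. The sets $K_\lambda$, $\lambda\in D_{2n}(q)$, partition $U^D_{2n}(q)$ into nonempty, pairwise distinct pieces (known result of André and Neto). $\mathbf{SC}^D_{2n}$ is the complex vector space of functions $U^D_{2n}(q)\to\mathbb C$ constant on superclasses, with basis $\{\kappa_\lambda\}_{\lambda\in D_{2n}(q)}$, $\kappa_\lambda$ being the indicator function of $K_\lambda$; $\mathbf{SC}^D_0=\mathbb C$. Put $\mathbf{SC}^D=\bigoplus_{n\ge0}\mathbf{SC}^D_{2n}$. $P$-basis. For $\lambda,\mu\in D_{2n}(q)$ write $\lambda\le\mu$ if $\mathcal A(\lambda)\subseteq\mathcal A(\mu)$, and set $P_\lambda=\sum_{\mu\ge\lambda}\kappa_\mu$ (sum over $\mu\in D_{2n}(q)$). Then $\{P_\lambda\}_{\lambda\in D_{2n}(q),\,n\ge 0}$ is a basis of $\mathbf{SC}^D$. Shift. For $\nu\in D_{2l}(q)$ and $k\ge0$, $\nu\uparrow^k$ is the set of arcs on the ground set $\{\pm(k+1),\dots,\pm(k+l)\}$ obtained from $\nu$ by relabelling $i\mapsto k+i$ and $-i\mapsto -(k+i)$ for $1\le i\le l$, keeping arc labels. For $\mu\in D_{2k}(q)$, $\mu\sqcup\nu\uparrow^k\in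 D_{2(k+l)}(q)$ is the $D$-partition of $[\pm(k+l)]$ whose set of arcs is the union of those of $\mu$ and of $\nu\uparrow^k$. Restriction and standardization. For $A\subseteq[n]$ let $A^c=[n]\setminus A$ and $[\pm A]=A\cup(-A)$. For $\lambda\in D_{2n}(q)$, $\lambda|_A$ has ground set $[\pm A]$ and consists of all arcs of $\lambda$ with both endpoints in $[\pm A]$. Write $\lambda=\lambda|_A\sqcup\lambda|_{A^c}$ when $\mathcal A(\lambda)=\mathcal A(\lambda|_A)\cup\mathcal A(\lambda|_{A^c})$. Let $\mathrm{st}_A:[\pm A]\to[\pm|A|]$ be the unique order-preserving bijection; $\mathrm{st}_A(\lambda|_A)\in D_{2|A|}(q)$ is obtained from $\lambda|_A$ by relabelling endpoints via $\mathrm{st}_A$. Unit and counit. The unit is $\kappa_\emptyset=P_\emptyset$, $\emptyset\in D_0(q)$; the counit $\epsilon:\mathbf{SC}^D\to\mathbb C$ takes the coefficient of this $\kappa_\emptyset\in\mathbf{SC}^D_0$. A Hopf algebra is a bialgebra (the coproduct and counit are algebra homomorphisms) with an antipode $S$, i.e. a linear map $S$ with $\sum_k S(a_k)b_k=\epsilon(a)1=\sum_k a_kS(b_k)$ whenever $\Delta(a)=\sum_k a_k\otimes b_k$. *)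

(* Defs.v *)
From HB Require Import structures.
From mathcomp Require Import all_boot all_order all_algebra.
From mathcomp Require Import boolp.
From mathcomp.multinomials Require Import freeg.
From mathcomp Require Import reals complex zify.

Set Implicit Arguments.
Unset Strict Implicit.
Unset Printing Implicit Defensive.

Import GRing.Theory.
Local Open Scope ring_scope.
Local Open Scope quotient_scope.

Section Tensor.
Variables (K : fieldType) (V W : lmodType K).

Inductive tensor_rel : {freeg (V * W)%type / K} -> Prop :=
| TensorRel0 : tensor_rel 0
| TensorRelP a x y : tensor_rel x -> tensor_rel y -> tensor_rel (a *: x + y)
| TensorRelL a v v' w :
    tensor_rel (<<(a *: v + v', w)>> - (a *: <<(v, w)>> + <<(v', w)>>))
| TensorRelR a v w w' :
    tensor_rel (<<(v, a *: w + w')>> - (a *: <<(v, w)>> + <<(v, w')>>)).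

Definition tensor_relb : {freeg (V * W)%type / K} -> bool :=
  fun x => `[< tensor_rel x >].

Fact tensor_relb_submod : submod_closed tensor_relb.
Proof.
split=> [|a x y /asboolP Hx /asboolP Hy]; apply/asboolP; first exact: TensorRel0.
exact: TensorRelP.
Qed.

HB.instance Definition _ :=
  GRing.isSubmodClosed.Build K {freeg (V * W)%type / K} tensor_relb
    tensor_relb_submod.

Definition tensor_rels : zmodClosed {freeg (V * W)%type / K} :=
  GRing.ZmodClosed.clone _ tensor_relb _.

(* V (x) W, as the free module on V * W modulo the bilinearity relations *)
Definition tensor : Type := Quotient.quot tensor_rels.
HB.instance Definition _ := GRing.Zmodule.on tensor.

Definition tensor_proj (x : {freeg (V * W)%type / K}) : tensor :=
  \pi_(Quotient.quot tensor_rels) x.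

Definition tensor_scale (a : K) (t : tensor) : tensor :=
  tensor_proj (a *: repr (t : Quotient.quot tensor_rels)).

Lemma tensor_projB : {morph tensor_proj : x y / x - y}.
Proof. by move=> x y; rewrite /tensor_proj !piE. Qed.

Lemma tensor_projD : {morph tensor_proj : x y / x + y}.
Proof. by move=> x y; rewrite /tensor_proj !piE. Qed.

Lemma tensor_projP x y :
  reflect (tensor_proj x = tensor_proj y) (tensor_relb (x - y)).
Proof.
have -> : tensor_relb (x - y) = (tensor_proj x == tensor_proj y)
  by exact: (Quotient.idealrBE tensor_rels x y).
exact: eqP.
Qed.

Lemma tensor_reprK t : tensor_proj (repr (t : Quotient.quot tensor_rels)) = t.
Proof. exact: reprK. Qed.

Lemma tensor_projZ a x : tensor_proj (a *: x) = tensor_scale a (tensor_proj x).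
Proof.
apply/tensor_projP; rewrite -scalerBr.
suff H : tensor_relb (x - repr (tensor_proj x : Quotient.quot tensor_rels)).
  by rewrite -[_ *: _]addr0; apply/asboolP/TensorRelP; [apply/asboolP|exact: TensorRel0].
by apply/tensor_projP; rewrite tensor_reprK.
Qed.

Fact tensor_scaleA a b t : tensor_scale a (tensor_scale b t) = tensor_scale (a * b) t.
Proof. by rewrite -[t]tensor_reprK -!tensor_projZ scalerA. Qed.
Fact tensor_scale1 : left_id 1 tensor_scale.
Proof. by move=> t; rewrite -[t]tensor_reprK -tensor_projZ scale1r. Qed.
Fact tensor_scaleDr : right_distributive tensor_scale +%R.
Proof.
move=> a s t; rewrite -[t]tensor_reprK -[s]tensor_reprK.
by rewrite -!(tensor_projZ, tensor_projD) scalerDr.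
Qed.
Fact tensor_scaleDl t : {morph tensor_scale^~ t : a b / a + b}.
Proof.
move=> a b; rewrite -[t]tensor_reprK.
by rewrite -!(tensor_projZ, tensor_projD) scalerDl.
Qed.

HB.instance Definition _ := GRing.Zmodule_isLmodule.Build K tensor
  tensor_scaleA tensor_scale1 tensor_scaleDr tensor_scaleDl.

Definition tens (v : V) (w : W) : tensor := tensor_proj <<(v, w)>>.

Definition bilin (M : lmodType K) (f : V -> W -> M) : Prop :=
  (forall w, linear (f^~ w)) /\ (forall v, linear (f v)).

Lemma tens_bilin : bilin tens.
Proof.
split=> [w a v v'|v a w w'];
  rewrite /tens -[a *: tensor_proj _]tensor_projZ -tensor_projD;
  apply/tensor_projP/asboolP; [exact: TensorRelL|exact: TensorRelR].
Qed.

(* The linear map induced by a bilinear f; see tlift_linear and tlift_tens. *)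
Definition tlift (M : lmodType K) (f : V -> W -> M) (t : tensor) : M :=
  fglift (fun p => f p.1 p.2) (repr (t : Quotient.quot tensor_rels)).

Lemma fglift_linear (M : lmodType K) (T : choiceType) (g : T -> M) :
  linear (fglift g).
Proof.
have fgB := lift_is_additive g.
have fg0 : fglift g 0 = 0 by rewrite -(subrr 0) fgB subrr.
have fgN x : fglift g (- x) = - fglift g x by rewrite -[- x]add0r fgB fg0 add0r.
have fgD x y : fglift g (x + y) = fglift g x + fglift g y.
  by rewrite -[in LHS](opprK y) fgB fgN opprK.
have fgsum (I : Type) (r : seq I) F :
    fglift g (\sum_(i <- r) F i) = \sum_(i <- r) fglift g (F i).
  by elim: r => [|i r IHr]; rewrite ?big_nil // !big_cons fgD IHr.
move=> a x y; rewrite fgD; congr (_ + _).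
rewrite -[x]freeg_sumE scaler_sumr !fgsum scaler_sumr.
apply: eq_bigr => p _.
suff -> k : a *: <<k *g p>> = <<(a * k) *g p>> :> {freeg T / K}.
  by rewrite !liftU scalerA.
by apply/eqP/freeg_eqP=> z; rewrite [LHS]coeff_fgscale !coeffU mulrA.
Qed.

Lemma tlift_proj (M : lmodType K) (f : V -> W -> M) x :
  bilin f -> tlift f (tensor_proj x) = fglift (fun p => f p.1 p.2) x.
Proof.
move=> [fL fR]; set g := (fun p => _).
suff H z : tensor_rel z -> fglift g z = 0.
  apply/eqP; rewrite -subr_eq0 -(lift_is_additive g) H //.
  by apply/asboolP/tensor_projP; rewrite tensor_reprK.
have gB := lift_is_additive g.
have gL := fglift_linear g.
have gU p : fglift g <<p>> = g p by rewrite liftU scale1r.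
elim=> [|a {}x y _ Hx _ Hy|a v v' w|a v w w'].
- by rewrite -(subrr 0) gB subrr.
- by rewrite gL Hx Hy scaler0 addr0.
- by rewrite gB gL !gU /g /= fL subrr.
- by rewrite gB gL !gU /g /= fR subrr.
Qed.

Lemma tlift_tens (M : lmodType K) (f : V -> W -> M) v w :
  bilin f -> tlift f (tens v w) = f v w.
Proof. by move=> fb; rewrite /tens tlift_proj // liftU scale1r. Qed.

Lemma tlift_linear (M : lmodType K) (f : V -> W -> M) :
  bilin f -> linear (tlift f).
Proof.
move=> fb a s t; rewrite -[t]tensor_reprK -[s]tensor_reprK.
rewrite -[a *: _]tensor_projZ -tensor_projD !tlift_proj //; exact: fglift_linear.
Qed.

End Tensor.

Notation "v \otimes w" := (tens v w) (at level 40, left associativity).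

Section Hopf.
Variable K : fieldType.

Definition tmap (V V' W W' : lmodType K) (f : V -> V') (g : W -> W') :
    tensor V W -> tensor V' W' :=
  tlift (fun v w => f v \otimes g w).

Definition tassoc (U V W : lmodType K) :
    tensor (tensor U V) W -> tensor U (tensor V W) :=
  tlift (fun s w => tlift (fun u v => u \otimes (v \otimes w)) s).

Variables (H : lmodType K) (m : {linear tensor H H -> H}) (e : H)
  (D : {linear H -> tensor H H}) (eps : {linear H -> K^o}).

(* (a (x) b) (c (x) d) = ac (x) bd *)
Definition tmul (s t : tensor H H) : tensor H H :=
  tlift (fun a b => tlift (fun c d => m (a \otimes c) \otimes m (b \otimes d)) t) s.

Record is_bialgebra : Prop := IsBialgebra {
  hopf_mulA : forall a b c, m (m (a \otimes b) \otimes c) = m (a \otimes m (b \otimes c));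
  hopf_mul1 : forall a, m (e \otimes a) = a;
  hopf_mulr1 : forall a, m (a \otimes e) = a;
  hopf_comulA : forall a, tassoc (tmap D id (D a)) = tmap id D (D a);
  hopf_counitl : forall a, tlift (fun x y => eps x *: y) (D a) = a;
  hopf_counitr : forall a, tlift (fun x y => eps y *: x) (D a) = a;
  hopf_comulM : forall a b, D (m (a \otimes b)) = tmul (D a) (D b);
  hopf_comul1 : D e = e \otimes e;
  hopf_counitM : forall a b, eps (m (a \otimes b)) = eps a * eps b;
  hopf_counit1 : eps e = 1 }.

Definition is_antipode (S : {linear H -> H}) : Prop :=
  forall a, tlift (fun x y => m (S x \otimes y)) (D a) = eps a *: e /\
            tlift (fun x y => m (x \otimes S y)) (D a) = eps a *: e.

Definition is_hopf : Prop := is_bialgebra /\ exists S, is_antipode S.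

End Hopf.

Section DirectSum.
Variables (K : fieldType) (V : nat -> lmodType K).

Definition dprod : Type := forall n, V n.
HB.instance Definition _ := Choice.on dprod.

Definition dadd (f g : dprod) : dprod := fun n => f n + g n.
Definition dopp (f : dprod) : dprod := fun n => - f n.
Definition dscale (a : K) (f : dprod) : dprod := fun n => a *: f n.
Definition dzero : dprod := fun n => 0.

Fact daddA : associative dadd.
Proof. by move=> f g h; apply: functional_extensionality_dep => n; exact: addrA. Qed.
Fact daddC : commutative dadd.
Proof. by move=> f g; apply: functional_extensionality_dep => n; exact: addrC. Qed.
Fact dadd0 : left_id dzero dadd.
Proof. by move=> f; apply: functional_extensionality_dep => n; exact: add0r. Qed.
Fact daddN : left_inverse dzero dopp dadd.
Proof. by move=> f; apply: functional_extensionality_dep => n; exact: addNr. Qed.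
HB.instance Definition _ :=
  GRing.isZmodule.Build dprod daddA daddC dadd0 daddN.

Fact dscaleA a b f : dscale a (dscale b f) = dscale (a * b) f.
Proof. by apply: functional_extensionality_dep => n; exact: scalerA. Qed.
Fact dscale1 : left_id 1 dscale.
Proof. by move=> f; apply: functional_extensionality_dep => n; exact: scale1r. Qed.
Fact dscaleDr : right_distributive dscale +%R.
Proof. by move=> a f g; apply: functional_extensionality_dep => n; exact: scalerDr. Qed.
Fact dscaleDl f : {morph dscale^~ f : a b / a + b}.
Proof. by move=> a b; apply: functional_extensionality_dep => n; exact: scalerDl. Qed.
HB.instance Definition _ := GRing.Zmodule_isLmodule.Build K dprod
  dscaleA dscale1 dscaleDr dscaleDl.

Definition dsum_fin (f : dprod) : bool :=
  `[< exists N, forall n, (N <= n)%N -> f n = 0 >].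

Fact dsum_fin_submod : submod_closed dsum_fin.
Proof.
split=> [|a f g /asboolP[M fM] /asboolP[N gN]]; apply/asboolP.
  by exists 0%N.
exists (maxn M N) => n; rewrite geq_max => /andP[Mn Nn].
by rewrite -[LHS]/(a *: f n + g n) fM // gN // scaler0 addr0.
Qed.
HB.instance Definition _ :=
  GRing.isSubmodClosed.Build K dprod dsum_fin dsum_fin_submod.

Record dsum : Type := DSum { dsum_val :> dprod; _ : dsum_fin dsum_val }.
HB.instance Definition _ := [isSub for dsum_val].
HB.instance Definition _ := [Choice of dsum by <:].
HB.instance Definition _ := [SubChoice_isSubLmodule of dsum by <:].

Fact dinj_fin n (x : V n) : dsum_fin (dfwith (fun k => 0 : V k) x).
Proof.
apply/asboolP; exists n.+1 => k nk.
by rewrite dfwith_out //; apply: contraTneq nk => ->; rewrite ltnn.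
Qed.

Definition dinj n (x : V n) : dsum := DSum (dinj_fin x).
End DirectSum.

(* [+-n] is 'I_(n + n): the order 1 < .. < n < -n < .. < -1 puts i at index    *)
(* i - 1 and -i at index 2n - i, so lshift n i stands for i + 1, rev_ord is   *)
(* the negation, and the order is that of the ordinals. For f : [l] -> [n],   *)
(* relabel f maps i to f i and -i to -(f i).                                  *)
Section Labels.

Definition relabel l n (f : 'I_l -> 'I_n) (x : 'I_(l + l)) : 'I_(n + n) :=
  match split x with
  | inl i => lshift n (f i)
  | inr j => rev_ord (lshift n (f (rev_ord j)))
  end.

Lemma relabel_pos l n (f : 'I_l -> 'I_n) i :
  relabel f (lshift l i) = lshift n (f i).
Proof. by rewrite /relabel (unsplitK (inl i)). Qed.

Lemma relabel_neg l n (f : 'I_l -> 'I_n) x :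
  relabel f (rev_ord x) = rev_ord (relabel f x).
Proof.
have E i : relabel f (rev_ord (lshift l i)) = rev_ord (lshift n (f i)).
  have -> : rev_ord (lshift l i) = rshift l (rev_ord i).
    by apply: val_inj => /=; have := ltn_ord i; lia.
  by rewrite /relabel (unsplitK (inr _)) rev_ordK.
case: (split_ordP x) => i ->; first by rewrite E relabel_pos.
have -> : rshift l i = rev_ord (lshift l (rev_ord i)).
  by apply: val_inj => /=; have := ltn_ord i; lia.
by rewrite E rev_ordK relabel_pos rev_ordK.
Qed.

Lemma relabel_lt l n (f : 'I_l -> 'I_n) :
  {homo f : i j / (i < j)%N} -> {mono relabel f : x y / (x < y)%N}.
Proof.
move=> fm; suff H : {homo relabel f : x y / (x < y)%N}.
  move=> x y; case: (ltngtP x y) => [/H ->|/H|/val_inj ->] //; last by rewrite ltnn.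
  by move=> H'; apply: negbTE; rewrite -leqNgt ltnW.
move=> x y; rewrite /relabel.
have sl i : split (lshift l i : 'I_(l + l)) = inl i := unsplitK (inl i).
have sr i : split (rshift l i : 'I_(l + l)) = inr i := unsplitK (inr i).
case: (split_ordP x) => i ->; case: (split_ordP y) => j -> /=;
  rewrite ?sl ?sr /=.
- exact: fm.
- by have := ltn_ord (f i); have := ltn_ord (f (rev_ord j)); lia.
- by have := ltn_ord j; lia.
rewrite ltn_add2l => ij.
have /fm : (rev_ord j < rev_ord i)%N by rewrite /=; have := ltn_ord j; lia.
by have := ltn_ord (f (rev_ord i)); lia.
Qed.

Lemma relabel_inj l n (f : 'I_l -> 'I_n) :
  {homo f : i j / (i < j)%N} -> injective (relabel f).
Proof.
move=> fm x y E; apply: val_inj; have m := relabel_lt fm.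
by case: (ltngtP x y) => // H; have := H; rewrite -m E ltnn.
Qed.

(* [+-A] *)
Definition pm n (A : {set 'I_n}) : {set 'I_(n + n)} :=
  [set lshift n i | i in A] :|: [set rev_ord (lshift n i) | i in A].

Lemma pm_neg n (A : {set 'I_n}) x : (rev_ord x \in pm A) = (x \in pm A).
Proof.
suff H y : y \in pm A -> rev_ord y \in pm A.
  by apply/idP/idP => /H //; rewrite rev_ordK.
rewrite !inE => /orP[] /imsetP[i iA ->]; rewrite ?rev_ordK.
  by rewrite [X in _ || X]imset_f ?orbT.
by rewrite imset_f.
Qed.

Lemma card_pm n (A : {set 'I_n}) : #|pm A| = (#|A| + #|A|)%N.
Proof.
rewrite /pm cardsU !card_imset ?[X in (_ - X)%N](_ : _ = 0%N) ?subn0 //.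
- apply: eq_card0 => x; rewrite !inE; apply/negbTE/negP.
  move=> /andP[/imsetP[i _ ->] /imsetP[j _ /(congr1 val) /=]].
  by have := ltn_ord i; have := ltn_ord j; lia.
- by move=> i j /rev_ord_inj /lshift_inj.
- exact: lshift_inj.
Qed.

(* The order-preserving bijection from [+-A] to [+-#|A|] maps x to its position *)
(* in [+-A]; only the values at x \in pm A matter (see st_lt and st_bound).     *)
Definition st n (A : {set 'I_n}) (x : 'I_(n + n)) : nat :=
  #|[set y in pm A | (y < x)%N]|.

Lemma st_lt n (A : {set 'I_n}) :
  {in pm A &, {mono st A : x y / (x < y)%N}}.
Proof.
have H : {in pm A &, {homo st A : x y / (x < y)%N}}.
  move=> x y xA yA xy; apply: proper_card; apply/properP; split.
    by apply/subsetP=> z; rewrite !inE => /andP[-> /ltn_trans ->].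
  by exists x; rewrite !inE ?xy ?ltnn ?andbF // andbT -in_setU.
move=> x y xA yA; case: (ltngtP x y) => [/H -> //|/H|/val_inj ->]; last by rewrite ltnn.
by move=> /(_ yA xA) H'; apply: negbTE; rewrite -leqNgt ltnW.
Qed.

Lemma st_inj n (A : {set 'I_n}) : {in pm A &, injective (st A)}.
Proof.
move=> x y xA yA E; apply: val_inj; have m := @st_lt n A.
by case: (ltngtP x y) => // H; have := H; rewrite -m // E ltnn.
Qed.

Lemma st_bound n (A : {set 'I_n}) x :
  x \in pm A -> (st A x < #|A| + #|A|)%N.
Proof.
move=> xA; rewrite -card_pm; apply: proper_card; apply/properP; split.
  by apply/subsetP=> z; rewrite inE => /andP[].
by exists x; rewrite // inE ltnn andbF.
Qed.

Lemma st_neg n (A : {set 'I_n}) x : x \in pm A ->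
  st A (rev_ord x) = (#|A| + #|A| - (st A x).+1)%N.
Proof.
move=> xA; set S := [set y in pm A | (x < y)%N].
have cS : #|S| = st A (rev_ord x).
  rewrite -(card_imset _ (@rev_ord_inj _)); apply: eq_card => y.
  rewrite [RHS]inE; apply/imsetP/andP => [[z]|[yA yx]].
    rewrite inE => /andP[zA xz] ->; rewrite pm_neg; split=> //=.
    by have := ltn_ord z; lia.
  exists (rev_ord y); rewrite ?rev_ordK // inE pm_neg yA /=; move: yx => /=.
  by have := ltn_ord y; have := ltn_ord x; lia.
have E : pm A = x |: ([set y in pm A | (y < x)%N] :|: S).
  apply/setP=> y; rewrite in_setU1 in_setU [y \in S]inE [y \in [set _ in _ | _]]inE.
  by rewrite -val_eqE; case: ltngtP => [||/val_inj ->] //=; rewrite ?andbT ?andbF ?orbF.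
rewrite -card_pm {1}E cardsU1 cardsU -cS /st.
have -> : [set y in pm A | (y < x)%N] :&: S = set0.
  apply/setP=> y; rewrite in_setI [y \in S]inE [y \in [set _ in _ | _]]inE in_set0.
  by case: ltngtP; rewrite ?andbF.
by rewrite in_setU [x \in S]inE [x \in [set _ in _ | _]]inE ltnn !andbF cards0; lia.
Qed.

End Labels.

Section DPartitions.
Variable F : finFieldType.

Definition larc n : Type := ('I_(n + n) * 'I_(n + n) * F)%type.
HB.instance Definition _ n := Finite.on (larc n).

(* j = rev_ord i encodes j = -i. *)
Record is_Dpart n (l : {set larc n}) : Prop := IsDpart {
  Dpart_arc : forall i j a, (i, j, a) \in l ->
    [/\ (i < j)%N, j != rev_ord i & a != 0];
  Dpart_label : forall i j a b, (i, j, a) \in l -> (i, j, b) \in l -> a = b;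
  Dpart_neg : forall i j a, (i, j, a) \in l ->
    (rev_ord j, rev_ord i, - a) \in l;
  Dpart_noncover : forall (i j : 'I_(n + n)) a (k : 'I_(n + n)), (i, j, a) \in l -> (i < k < j)%N ->
    forall b, (i, k, b) \notin l /\ (k, j, b) \notin l }.

Definition Dpart n : Type := {l : {set larc n} | `[< is_Dpart l >]}.
HB.instance Definition _ n := Finite.on (Dpart n).

Definition MkDpart n (l : {set larc n}) (H : is_Dpart l) : Dpart n :=
  exist (fun l => `[< is_Dpart l >]) l (asboolT H).

Definition arcs n (l : Dpart n) : {set larc n} := val l.

Lemma arcsP n (l : Dpart n) : is_Dpart (arcs l).
Proof. exact/asboolP/(valP l). Qed.

Fact Dpart0_proof n : is_Dpart (set0 : {set larc n}).
Proof. by split=> [i j a|i j a b|i j a|i j a k]; rewrite inE. Qed.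
Definition Dpart0 n : Dpart n := MkDpart (@Dpart0_proof n).

Definition relabel_arcs l n (f : 'I_l -> 'I_n) (A : {set larc l}) : {set larc n} :=
  [set (relabel f t.1.1, relabel f t.1.2, t.2) | t in A].

Lemma relabel_arcsP l n (f : 'I_l -> 'I_n) (A : {set larc l}) i j a :
  (i, j, a) \in relabel_arcs f A ->
  exists x y, [/\ i = relabel f x, j = relabel f y & (x, y, a) \in A].
Proof. by case/imsetP=> -[[x y] b] H [-> -> ->]; exists x, y. Qed.

Lemma relabel_arcs_Dpart l n (f : 'I_l -> 'I_n) (A : {set larc l}) :
  {homo f : i j / (i < j)%N} -> is_Dpart A -> is_Dpart (relabel_arcs f A).
Proof.
move=> fm [H1 H2 H3 H4]; have fi := relabel_inj fm.
split=> [i j a|i j a b|i j a|i j a k] /relabel_arcsP[x [y [-> -> xy]]].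
- case: (H1 _ _ _ xy) => ? ? ?; rewrite relabel_lt // -relabel_neg.
  by rewrite (inj_eq fi).
- by case/relabel_arcsP=> x' [y' [/fi <- /fi <-]]; exact: H2 xy.
- by rewrite -!relabel_neg; apply/imsetP; exists (rev_ord y, rev_ord x, - a); rewrite ?H3.
move=> /andP[xk ky] b; split; apply/negP.
  case/relabel_arcsP=> x' [z [/fi <- E]]; rewrite E !relabel_lt // in xk ky.
  by apply/negP; case: (H4 _ _ _ z xy _ b); rewrite ?xk.
case/relabel_arcsP=> z [y' [E /fi <-]]; rewrite E !relabel_lt // in xk ky.
by apply/negP; case: (H4 _ _ _ z xy _ b); rewrite ?xk.
Qed.

Lemma Dpart_union n (A B : {set larc n}) : is_Dpart A -> is_Dpart B ->
  (forall s t, s \in A -> t \in B -> s.1.1 != t.1.1 /\ s.1.2 != t.1.2) ->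
  is_Dpart (A :|: B).
Proof.
move=> [A1 A2 A3 A4] [B1 B2 B3 B4] AB.
have ABl i j k a b : (i, j, a) \in A -> (i, k, b) \in B -> False.
  by move=> /AB H /H[]; rewrite eqxx.
have ABr i j k a b : (i, k, a) \in A -> (j, k, b) \in B -> False.
  by move=> /AB H /H[_]; rewrite eqxx.
split=> [i j a|i j a b|i j a|i j a k]; rewrite !in_setU => /orP[] H.
- exact: A1 H.
- exact: B1 H.
- by case/orP=> [/(A2 _ _ _ _ H)|/(ABl _ _ _ _ _ H)].
- by case/orP=> [H'|/(B2 _ _ _ _ H)] //; case: (ABl _ _ _ _ _ H' H).
- by rewrite A3.
- by rewrite B3 ?orbT.
- move=> ikj b; case: (A4 _ _ _ _ H ikj b) => /negbTE n1 /negbTE n2.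
  rewrite !in_setU n1 n2 /=; split; apply/negP; [exact: ABl H|exact: ABr H].
- move=> ikj b; case: (B4 _ _ _ _ H ikj b) => /negbTE n1 /negbTE n2.
  rewrite !in_setU n1 n2 !orbF; split; apply/negP => H'.
    exact: ABl H' H.
  exact: ABr H' H.
Qed.

Lemma relabel_shift_neq k l (x : 'I_(k + k)) (y : 'I_(l + l)) :
  relabel (@lshift k l) x != relabel (@rshift k l) y.
Proof.
rewrite -val_eqE /relabel; case: (split x) => i; case: (split y) => j /=.
- by have := ltn_ord i; lia.
- by have := ltn_ord i; have := ltn_ord j; lia.
- by have := ltn_ord i; have := ltn_ord j; lia.
by have := ltn_ord i; have := ltn_ord j; lia.
Qed.

(* The ground set of nu shifted by k is +-{k + 1, .., k + l}. *)
Definition shift_union_arcs k l (mu : Dpart k) (nu : Dpart l) :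
    {set larc (k + l)} :=
  relabel_arcs (@lshift k l) (arcs mu) :|: relabel_arcs (@rshift k l) (arcs nu).

Fact shift_union_proof k l (mu : Dpart k) (nu : Dpart l) :
  is_Dpart (shift_union_arcs mu nu).
Proof.
apply: Dpart_union.
- by apply: relabel_arcs_Dpart (arcsP mu) => i j.
- by apply: relabel_arcs_Dpart (arcsP nu) => i j /=; rewrite ltn_add2l.
move=> s t /imsetP[u _ ->] /imsetP[v _ ->] /=.
by split; exact: relabel_shift_neq.
Qed.
Definition shift_union k l (mu : Dpart k) (nu : Dpart l) : Dpart (k + l) :=
  MkDpart (shift_union_proof mu nu).

Definition restr n (A : {set 'I_n}) (l : Dpart n) : {set larc n} :=
  [set t in arcs l | (t.1.1 \in pm A) && (t.1.2 \in pm A)].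

Definition splits n (A : {set 'I_n}) (l : Dpart n) : bool :=
  arcs l == restr A l :|: restr (~: A) l.

Definition std_arcs n (A : {set 'I_n}) (l : Dpart n) : {set larc #|A|} :=
  [set t : larc #|A| | [exists s in restr A l,
    [&& t.1.1 == st A s.1.1 :> nat, t.1.2 == st A s.1.2 :> nat & t.2 == s.2]]].

Lemma std_arcsP n (A : {set 'I_n}) (l : Dpart n) (i j : 'I_(#|A| + #|A|)) a :
  reflect (exists x y, [/\ x \in pm A, y \in pm A, i = st A x :> nat,
                           j = st A y :> nat & (x, y, a) \in arcs l])
          ((i, j, a) \in std_arcs A l).
Proof.
rewrite inE; apply: (iffP exists_inP) => [[[[x y] b]]|[x [y [xA yA ix jy H]]]].
  by rewrite inE => /and3P[H /= xA yA] /and3P[/eqP ix /eqP jy /eqP ->]; exists x, y.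
by exists (x, y, a); [rewrite inE H /= xA|rewrite /= ix jy !eqxx].
Qed.

Fact std_proof n (A : {set 'I_n}) (l : Dpart n) : is_Dpart (std_arcs A l).
Proof.
have [H1 H2 H3 H4] := arcsP l.
have lt := @st_lt n A.
split=> [i j a|i j a b|i j a|i j a k] /std_arcsP[x [y [xA yA ix jy xy]]].
- case: (H1 _ _ _ xy) => xly yx a0; rewrite ix jy lt //; split=> //.
  apply: contra yx => /eqP /(congr1 val) /=; rewrite ix jy -st_neg //.
  by move/(st_inj yA) ->; rewrite ?pm_neg.
- case/std_arcsP=> x' [y' [x'A y'A ix' jy']].
  have -> : x' = x by apply: (@st_inj _ A) => //; rewrite -ix'.
  have -> : y' = y by apply: (@st_inj _ A) => //; rewrite -jy'.
  exact: H2 xy.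
- apply/std_arcsP; exists (rev_ord y), (rev_ord x); rewrite !pm_neg !st_neg //.
  by rewrite -ix -jy; split=> //; exact: H3.
rewrite ix jy => /andP[xk ky] b; split; apply/negP => /std_arcsP[u [v [uA vA iu kv H]]].
  have E : u = x by apply: (@st_inj _ A) => //; rewrite -iu.
  rewrite E in H; move: xk ky; rewrite kv !lt // => xv vy.
  by case: (H4 _ _ _ v xy _ b); rewrite ?xv // H.
have E : v = y by apply: (@st_inj _ A) => //; rewrite -kv.
rewrite E in H; move: xk ky; rewrite iu !lt // => xu uy.
by case: (H4 _ _ _ u xy _ b); rewrite ?xu // H.
Qed.
(* st_A(l|_A) *)
Definition std n (A : {set 'I_n}) (l : Dpart n) : Dpart #|A| :=
  MkDpart (std_proof A l).

Definition unip m : {set 'M[F]_m} :=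
  [set u : 'M_m | [forall i, u i i == 1] &
                  [forall i : 'I_m, forall j : 'I_m, (j < i)%N ==> (u i j == 0)]].

Definition antidiag n : 'M[F]_n := \matrix_(i, j) (j == rev_ord i)%:R.

Definition UD n : {set 'M[F]_(n + n)} :=
  [set block_mx P (P *m Q) 0 (antidiag n *m (invmx P)^T *m antidiag n)
    | P : 'M[F]_n in unip n,
      Q : 'M[F]_n in [set Q : 'M[F]_n | antidiag n *m Q^T *m antidiag n == - Q]].

Definition arc_mx n (l : Dpart n) : 'M[F]_(n + n) :=
  \sum_(t in arcs l) t.2 *: delta_mx t.1.1 t.1.2.

Definition double_coset n (l : Dpart n) : {set 'M[F]_(n + n)} :=
  [set u *m arc_mx l *m v
    | u : 'M[F]_(n + n) in unip (n + n), v : 'M[F]_(n + n) in unip (n + n)].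

Definition superclass n (l : Dpart n) : {set 'M[F]_(n + n)} :=
  UD n :&: [set x + 1%:M | x : 'M[F]_(n + n) in double_coset l].

Lemma unipP m (u : 'M[F]_m) :
  reflect (forall i j : 'I_m, (j <= i)%N -> u i j = (i == j)%:R) (u \in unip m).
Proof.
rewrite inE; apply: (iffP andP) => [[/forallP u1 /forallP u0] i j|H].
  rewrite leq_eqVlt => /orP[/eqP/val_inj ->|ji]; first by rewrite eqxx; exact/eqP.
  have /forallP/(_ j)/implyP/(_ ji)/eqP -> := u0 i.
  by rewrite -val_eqE gtn_eqF.
split; apply/forallP => i; first by rewrite H // eqxx.
by apply/forallP => j; apply/implyP => ji; rewrite H 1?ltnW // -val_eqE gtn_eqF.
Qed.

Lemma unip1 m : 1%:M \in unip m.
Proof. by apply/unipP => i j _; rewrite mxE. Qed.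

Lemma unipM m (u v : 'M[F]_m) : u \in unip m -> v \in unip m -> u *m v \in unip m.
Proof.
move=> /unipP hu /unipP hv; apply/unipP => i j ji; rewrite mxE (bigD1 j) //=.
rewrite hv // eqxx mulr1 hu // big1 ?addr0 // => k kj.
have [ki|ik] := leqP k i; last first.
  by rewrite hv ?(leq_trans ji) 1?ltnW // (negbTE kj) mulr0.
rewrite hu //; case: eqP => [E|_]; last by rewrite mul0r.
by rewrite -E in kj *; rewrite hv // (negbTE kj) mulr0.
Qed.

Lemma unip_unit m (u : 'M[F]_m) : u \in unip m -> u \in unitmx.
Proof.
move=> /unipP hu; rewrite unitmxE -det_tr det_trig.
  by rewrite big1 ?unitr1 // => i _; rewrite mxE hu // eqxx.
apply/is_trig_mxP => i j ij; rewrite mxE hu 1?ltnW //.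
by rewrite -val_eqE gtn_eqF.
Qed.

Lemma unipV m (u : 'M[F]_m) : u \in unip m -> invmx u \in unip m.
Proof.
move=> hu; have uu := unip_unit hu.
have ui : injective (mulmx u : 'M_m -> 'M_m) by apply: can_inj (mulKmx uu).
have /setP/(_ 1%:M) : [set u *m v | v in unip m] = unip m.
  apply/eqP; rewrite eqEcard card_imset // leqnn andbT.
  by apply/subsetP => _ /imsetP[v hv ->]; exact: unipM.
rewrite unip1 => /imsetP[v hv E].
by rewrite (_ : invmx u = v) // -[LHS]mulmx1 E mulKmx.
Qed.

Lemma superclass_orbit n (l mu : Dpart n) x y :
  x \in superclass mu -> y \in superclass mu ->
  x \in superclass l -> y \in superclass l.
Proof.
have sub1 (z w : 'M[F]_(n + n)) : z = w + 1%:M -> w = z - 1%:M.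
  by move=> ->; rewrite addrK.
move=> /setIP[_ /imsetP[x1 /imset2P[u v hu hv ->] /sub1 Ex]].
move=> /setIP[yU /imsetP[y1 /imset2P[u' v' hu' hv' ->] Ey]].
move=> /setIP[_ /imsetP[x2 /imset2P[a b ha hb ->] /sub1 Ex']].
apply/setIP; split=> //; apply/imsetP; exists (y - 1%:M); last by rewrite subrK.
rewrite Ey addrK.
have {Ex Ex'} E : u *m arc_mx mu *m v = a *m arc_mx l *m b by rewrite Ex Ex'.
have -> : arc_mx mu = invmx u *m (a *m arc_mx l *m b) *m invmx v.
  by rewrite -E !mulmxA mulVmx ?unip_unit // mul1mx mulmxK ?unip_unit.
apply/imset2P; exists (u' *m invmx u *m a) (b *m invmx v *m v').
- by rewrite !unipM ?unipV.
- by rewrite !unipM ?unipV.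
by rewrite !mulmxA.
Qed.

Lemma UD1 n : 1%:M \in UD n.
Proof.
apply/imset2P; exists 1%:M 0; first exact: unip1.
  by rewrite inE trmx0 mulmx0 mul0mx oppr0.
rewrite mulmx0 invmx1 trmx1 mulmx1 (_ : antidiag n *m antidiag n = 1%:M).
  by rewrite -scalar_mx_block.
apply/matrixP => i j; rewrite !mxE (bigD1 (rev_ord i)) //= !mxE eqxx mul1r.
rewrite rev_ordK eq_sym big1 ?addr0 // => k ki.
by rewrite !mxE (negbTE ki) mul0r.
Qed.

Definition UDtype n : Type := {x : 'M[F]_(n + n) | x \in UD n}.
HB.instance Definition _ n := Finite.on (UDtype n).
Definition UDone n : UDtype n := exist _ 1%:M (UD1 n).

Section SuperclassFunctions.
Variable C : fieldType.

Definition is_scfun n (f : {ffun UDtype n -> C^o}) : bool :=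
  [forall l : Dpart n, forall x, forall y,
    (val x \in superclass l) && (val y \in superclass l) ==> (f x == f y)].

Lemma is_scfunP n (f : {ffun UDtype n -> C^o}) :
  reflect (forall (l : Dpart n) x y, val x \in superclass l ->
             val y \in superclass l -> f x = f y)
          (is_scfun f).
Proof.
apply: (iffP forallP) => H l.
  move=> x y xl yl; have /forallP/(_ x)/forallP/(_ y) := H l.
  by rewrite xl yl => /eqP.
by apply/forallP=> x; apply/forallP=> y; apply/implyP=> /andP[xl yl]; apply/eqP/(H l).
Qed.

Fact is_scfun_submod n : submod_closed (@is_scfun n).
Proof.
split=> [|a f g /is_scfunP fP /is_scfunP gP]; apply/is_scfunP => l x y xl yl.
  by rewrite !ffunE.
by rewrite !ffunE (fP l x y) // (gP l x y).
Qed.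
HB.instance Definition _ n := GRing.isSubmodClosed.Build C {ffun UDtype n -> C^o}
  (@is_scfun n) (@is_scfun_submod n).

Record SCn n : Type :=
  MkSCn { scfun :> {ffun UDtype n -> C^o}; _ : is_scfun scfun }.
HB.instance Definition _ n := [isSub for @scfun n].
HB.instance Definition _ n := [Choice of SCn n by <:].
HB.instance Definition _ n := [SubChoice_isSubLmodule of SCn n by <:].

Fact kappa_proof n (l : Dpart n) :
  is_scfun [ffun x : UDtype n => (val x \in superclass l)%:R : C^o].
Proof.
apply/is_scfunP=> mu x y xmu ymu; rewrite !ffunE.
suff -> : (val x \in superclass l) = (val y \in superclass l) by [].
by apply/idP/idP; apply: superclass_orbit; eassumption.
Qed.
Definition kappa n (l : Dpart n) : SCn n := MkSCn (kappa_proof l).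

Definition SC : lmodType C := dsum (fun n => SCn n).

Definition scinj n (f : SCn n) : SC := @dinj C (fun n => SCn n) n f.

Definition Pbasis n (l : Dpart n) : SC :=
  scinj (\sum_(mu : Dpart n | arcs l \subset arcs mu) kappa mu).

Definition scone : SC := scinj (kappa (Dpart0 0)).

(* UD 0 is trivial, so the coefficient of kappa_0 in degree 0 is the value at *)
(* the identity; see sccounit_coef.                                           *)
Definition sccounit (f : SC) : C^o := dsum_val f 0%N (UDone 0).

Fact sccounit_linear : linear sccounit.
Proof. by move=> a f g; rewrite /sccounit /= !ffunE. Qed.
HB.instance Definition _ := GRing.isLinear.Build C SC C^o _ sccounit sccounit_linear.

Lemma sccounit_coef (f : SC) : dsum_val f 0%N = sccounit f *: kappa (Dpart0 0).
Proof.
have all1 (x : UDtype 0) : x = UDone 0.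
  by apply: val_inj => /=; apply/matrixP => -[].
apply: val_inj; apply/ffunP => x; rewrite /= !ffunE (all1 x) /sccounit.
rewrite (_ : _ \in _ = true) ?[_ *: _]mulr1 //.
apply/setIP; split; first exact: UD1.
apply/imsetP; exists 0; last by rewrite add0r.
by apply/imset2P; exists 1%:M 1%:M; rewrite ?unip1 // /arc_mx big_set0 mulmx0 mul0mx.
Qed.

End SuperclassFunctions.
End DPartitions.

Section StructureMaps.
Variables (F : finFieldType) (C : fieldType).
Local Notation SC := (SC F C).
Local Notation P := (Pbasis C).

Definition is_Pproduct (m : {linear tensor SC SC -> SC}) : Prop :=
  forall k l (mu : Dpart F k) (nu : Dpart F l),
    m (P mu \otimes P nu) = P (shift_union mu nu).

Definition is_Pcoproduct (D : {linear SC -> tensor SC SC}) : Prop :=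
  forall n (l : Dpart F n),
    D (P l) = \sum_(A : {set 'I_n} | splits A l)
                P (std A l) \otimes P (std (~: A) l).

End StructureMaps.

(* Main.v *)
(** A matrix of the type D group is a unipotent [x] that is orthogonal for the
    antidiagonal form. The Cayley transform turns [x - 1] into a skew strictly
    upper triangular [y], up to a unipotent factor, and [U y U] contains exactly one
    rook matrix, which by uniqueness is again skew, that is, the matrix of a
    D-partition; conversely the Cayley transform of [arc_mx l] lies in the
    superclass of [l]. So the superclasses partition the group and, the order by
    inclusion being unitriangular, the [P]s form a basis.

    On the basis, product and coproduct are a monoid law on D-partitions and a sum over
    the sets [A] that no arc leaves. Iterating the coproduct on either side
    sums over the pairs of such sets [B] included in [A], whence coassociativity.
    For the antipode, in the convolution algebra of functions on D-partitions every
    function that is 1 in degree 0 has a left inverse of the same kind, by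
    recursion on the degree; the left inverse of a left inverse shows that
    the inverse of the identity is two-sided. *)

Require Import Defs.
From HB Require Import structures.
From mathcomp Require Import all_boot all_order all_algebra fingroup cyclic finalg.
From mathcomp.multinomials Require Import freeg.
From mathcomp Require Import boolp reals complex zify ring.

Set Implicit Arguments.
Unset Strict Implicit.
Unset Printing Implicit Defensive.

Import GRing.Theory.
Local Open Scope ring_scope.

(** * Superclasses *)

Section Flip.
Variables (F : fieldType) (m : nat).
Implicit Types A B : 'M[F]_m.

(* The adjoint for the bilinear form with antidiagonal Gram matrix. *)
Definition flip A : 'M[F]_m := \matrix_(i, j) A (rev_ord j) (rev_ord i).

Lemma flipK : involutive flip.
Proof. by move=> A; apply/matrixP => i j; rewrite !mxE !rev_ordK. Qed.

Lemma flipM A B : flip (A *m B) = flip B *m flip A.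
Proof.
apply/matrixP => i j; rewrite !mxE (reindex_inj rev_ord_inj) /=.
by apply: eq_bigr => k _; rewrite !mxE mulrC.
Qed.

Lemma flip1 : flip 1%:M = 1%:M.
Proof. by apply/matrixP => i j; rewrite !mxE (inj_eq rev_ord_inj) eq_sym. Qed.

Lemma flipD A B : flip (A + B) = flip A + flip B.
Proof. by apply/matrixP => i j; rewrite !mxE. Qed.

Lemma flipN A : flip (- A) = - flip A.
Proof. by apply/matrixP => i j; rewrite !mxE. Qed.

Lemma flipZ a A : flip (a *: A) = a *: flip A.
Proof. by apply/matrixP => i j; rewrite !mxE. Qed.

End Flip.

(** * Rook matrices as representatives of the double cosets of the unitriangular group *)

Section Rook.
Variables (F : finFieldType) (m : nat).
Local Notation unip := (unip F).
Implicit Types x y z u v : 'M[F]_m.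

Lemma unip_flip u : u \in unip m -> flip u \in unip m.
Proof.
move=> /unipP hu; apply/unipP => i j ji.
rewrite mxE hu ?(inj_eq rev_ord_inj) 1?eq_sym //=.
by have := ltn_ord i; have := ltn_ord j; lia.
Qed.

Definition strict_upper y := forall i j : 'I_m, (j <= i)%N -> y i j = 0.

Lemma strict_upper_unip y : strict_upper y -> y + 1%:M \in unip m.
Proof. by move=> hy; apply/unipP => i j ji; rewrite !mxE hy // add0r. Qed.

Lemma strict_upper_mul u y v :
  u \in unip m -> v \in unip m -> strict_upper y -> strict_upper (u *m y *m v).
Proof.
move=> hu hv /strict_upper_unip hy i j ji.
have -> : u *m y *m v = u *m (y + 1%:M) *m v - u *m v.
  by rewrite mulmxDr mulmxDl mulmx1 addrK.
have /unipP h1 := unipM (unipM hu hy) hv; have /unipP h2 := unipM hu hv.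
have subE (a b : 'M[F]_m) : (a - b) i j = a i j - b i j by rewrite !mxE.
by rewrite subE h1 // h2 // subrr.
Qed.

Lemma unip_transvection (r s : 'I_m) a :
  (r < s)%N -> 1%:M + a *: delta_mx r s \in unip m.
Proof.
move=> rs; apply/unipP => i j ji; rewrite !mxE.
case: (i =P r) => [ir|]; case: (j =P s) => [js|]; rewrite ?mulr0 ?addr0 //=.
by move: ji; rewrite ir js leqNgt rs.
Qed.

Lemma transvection_rowE (r s : 'I_m) a z i j :
  ((1%:M + a *: delta_mx r s) *m z *m 1%:M) i j = z i j + (i == r)%:R * (a * z s j).
Proof.
rewrite mulmx1 mulmxDl mul1mx -scalemxAl !mxE (bigD1 s) //= big1 => [|c cs].
  by rewrite !mxE eqxx andbT addr0; ring.
by rewrite mxE (negbTE cs) andbF mul0r.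
Qed.

Lemma transvection_colE (r s : 'I_m) a z i j :
  (1%:M *m z *m (1%:M + a *: delta_mx r s)) i j = z i j + (j == s)%:R * (a * z i r).
Proof.
rewrite mul1mx mulmxDr mulmx1 -scalemxAr !mxE (bigD1 r) //= big1 => [|c cr].
  by rewrite !mxE eqxx addr0; ring.
by rewrite mxE (negbTE cr) mulr0.
Qed.

Definition rook z : Prop :=
  (forall i j k, z i j != 0 -> z i k != 0 -> j = k) /\
  (forall i j k, z i k != 0 -> z j k != 0 -> i = j).

Lemma rookN z : rook z -> rook (- z).
Proof. by move=> [zR zC]; split=> i j k; rewrite !mxE !oppr_eq0; [exact: zR|exact: zC]. Qed.

Lemma rook_flip z : rook z -> rook (flip z).
Proof.
move=> [zR zC]; split=> i j k; rewrite !mxE => a b; apply: rev_ord_inj.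
  exact: zC a b.
exact: zR a b.
Qed.

(** Where [x] is nonzero, [u *m x] keeps the entry of [x], because that column of [x] has no other
    entry; dually a row of [z *m v] is a multiple of one row of [v]. Triangularity then only allows
    the entry of [z] in row [i] to lie at or to the left of that of [x], and a strictly smaller
    column is excluded by induction. *)
Lemma rook_sub x z u v : u \in unip m -> v \in unip m -> rook x -> rook z ->
  u *m x = z *m v -> forall i j, x i j != 0 -> z i j = x i j.
Proof.
move=> /unipP hu /unipP hv [xR xC] [zR zC] E i j.
have uxE k l : x k l != 0 -> (u *m x) k l = x k l.
  move=> xkl; rewrite mxE (bigD1 k) //= hu // eqxx mul1r big1 ?addr0 // => r rk.
  have /eqP-> : x r l == 0; last by rewrite mulr0.
  by apply: contraNT rk => xrl; apply/eqP/(xC _ _ _ xrl xkl).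
have zvE k l s : z k s != 0 -> (z *m v) k l = z k s * v s l.
  move=> zks; rewrite mxE (bigD1 s) //= big1 ?addr0 // => r rs.
  have /eqP-> : z k r == 0; last by rewrite mul0r.
  by apply: contraNT rs => zkr; apply/eqP/(zR _ _ _ zkr zks).
(* The measure drops when the position moves left without moving up. *)
have [d] := ubnP (j + (m - i))%N; elim: d i j => // d IH i j le_d xij.
have [s zis] : exists s, z i s != 0.
  apply: contrapT => H; move: (xij); rewrite -(uxE _ _ xij) E mxE big1 ?eqxx // => s _.
  by have [->|zis] := eqVneq (z i s) 0; [rewrite mul0r|case: H; exists s].
have Exz : x i j = z i s * v s j by rewrite -zvE // -E uxE.
have sj : (s <= j)%N.
  rewrite leqNgt; apply/negP => js; move: xij; rewrite Exz hv 1?ltnW //.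
  by rewrite -val_eqE gtn_eqF // mulr0 eqxx.
suff js : s = j by rewrite Exz js hv // eqxx mulr1 -js.
apply/eqP; rewrite -val_eqE eqn_leq sj /= leqNgt; apply/negP => lt_sj.
(* If [s < j], the nonzero entry [z i s] equals the entry of [u *m x] there, so column [s] of [x] is
   nonzero in some row [r] not above [i]. Induction at [(r, s)] forces [r = i], and row [i] of [x]
   would have two entries. *)
have [r xrs ir] : exists2 r, x r s != 0 & (i <= r)%N.
  apply: contrapT => H; move: (zis); rewrite -[z i s]mulr1.
  have -> : 1 = v s s by rewrite hv // eqxx.
  rewrite -zvE // -E mxE big1 ?eqxx // => r _.
  have [ir|ri] := leqP i r; last by rewrite hu 1?ltnW // -val_eqE gtn_eqF // mul0r.
  by have [->|xrs] := eqVneq (x r s) 0; [rewrite mulr0|case: H; exists r].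
have zrs : z r s = x r s by apply: IH xrs; have := ltn_ord r; lia.
have ri : r = i by apply: zC zis; rewrite zrs.
by move: lt_sj; rewrite (xR i s j) ?ltnn // -ri.
Qed.

(** By [rook_sub] in both directions, each of the two matrices contains the nonzero entries of the
    other. *)
Lemma rook_unique x u v : u \in unip m -> v \in unip m ->
  rook x -> rook (u *m x *m v) -> u *m x *m v = x.
Proof.
move=> hu hv hx hz; set z := u *m x *m v.
have hxz : forall i j, x i j != 0 -> z i j = x i j.
  apply: (rook_sub hu (unipV hv)) => //.
  by rewrite mulmxK ?unip_unit.
have hzx : forall i j, z i j != 0 -> x i j = z i j.
  apply: (rook_sub (unipV hu) hv) => //.
  by rewrite /z -!mulmxA mulKmx ?unip_unit.
apply/matrixP => i j; have [xij|/hxz //] := eqVneq (x i j) 0.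
by have [->|/hzx //] := eqVneq (z i j) 0.
Qed.

(* Positions are cleared column by column from the left, and from the bottom *)
(* to the top of each column, so that the pivots used at a position come first. *)
Definition position (i j : 'I_m) : nat := (j * m + rev_ord i)%N.

Lemma position_lt (i j k l : 'I_m) :
  (position i j < position k l)%N = (j < l)%N || (j == l) && (k < i)%N.
Proof.
rewrite /position -[j == l]val_eqE /=.
have := ltn_ord i; have := ltn_ord k; have := ltn_ord j; have := ltn_ord l.
case: (ltngtP j l) => [jl|lj|->] /= *; last by apply/idP/idP; lia.
  have : (j.+1 * m <= l * m)%N by rewrite leq_mul2r jl orbT.
  by rewrite mulSn; lia.
have : (l.+1 * m <= j * m)%N by rewrite leq_mul2r lj orbT.
by rewrite mulSn; lia.
Qed.

Lemma position_inj (i j k l : 'I_m) :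
  position i j = position k l -> i = k /\ j = l.
Proof.
move=> E; have := position_lt i j k l; have := position_lt k l i j.
rewrite E ltnn -!val_eqE /= => H1 H2.
by split; apply: val_inj => /=; move: H1 H2;
  case: (ltngtP j l) => //= _; case: (ltngtP i k).
Qed.

(** Of two nonzero entries in one row or column, the later one in the order of [position] is
    blocked, so a matrix without blocked positions is rook. Whether a position is blocked depends
    only on the entries up to it. *)
Definition blocked z i j : Prop :=
  z i j != 0 /\
  ((exists2 k : 'I_m, (i < k)%N & z k j != 0) \/
   (exists2 l : 'I_m, (l < j)%N & z i l != 0)).

Lemma blocked_eq z z' i j :
  (forall k l, (position k l <= position i j)%N -> z k l = z' k l) ->
  blocked z i j -> blocked z' i j.
Proof.
move=> E [zij H]; split; first by rewrite -E.
case: H => [[k ik]|[l lj]]; [left; exists k|right; exists l] => //;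
  by rewrite -E // ltnW // position_lt ?ik ?lj ?eqxx ?orbT.
Qed.

(** Gaussian elimination in the order of [position]: after [t] rounds no position below [t] is
    blocked, and a round changes nothing before the position that it clears. *)
Lemma rook_exists y :
  exists u v, [/\ u \in unip m, v \in unip m & rook (u *m y *m v)].
Proof.
suff H t : exists u v, [/\ u \in unip m, v \in unip m &
    forall i j, (position i j < t)%N -> ~ blocked (u *m y *m v) i j].
  (* Every position is below [m * m + m]. *)
  have [u [v [hu hv nb]]] := H (m * m + m)%N; exists u, v; split=> //.
  set z := u *m y *m v in nb *.
  have {}nb i j : ~ blocked z i j.
    apply: nb; rewrite /position /=.
    have := ltn_ord i; have : (j * m <= m * m)%N by rewrite leq_mul2r ltnW ?orbT.
    by lia.
  split=> [i j k zij zik|i j k zik zjk]; apply: val_inj => /=.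
    case: (ltngtP j k) => // jk; exfalso.
      by apply: (nb i k); split=> //; right; exists j.
    by apply: (nb i j); split=> //; right; exists k.
  case: (ltngtP i j) => // ij; exfalso.
    by apply: (nb i k); split=> //; left; exists j.
  by apply: (nb j k); split=> //; left; exists i.
elim: t => [|t [u [v [hu hv nb]]]]; first by exists 1%:M, 1%:M; rewrite unip1.
set z := u *m y *m v in nb *.
have [[i [j [Et bij]]]|nbt] :=
    pselect (exists i j, position i j = t /\ blocked z i j); last first.
  exists u, v; split=> // i j; rewrite ltnS leq_eqVlt => /orP[/eqP Et|/nb //] bij.
  by apply: nbt; exists i, j.
suff [u' [v' [hu' hv' zij0 zE]]] : exists u' v', [/\ u' \in unip m, v' \in unip m,
    (u' *m z *m v') i j = 0 &
    forall k l, (position k l < position i j)%N -> (u' *m z *m v') k l = z k l].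
  exists (u' *m u), (v *m v'); split; rewrite ?unipM // => k l.
  have -> : u' *m u *m y *m (v *m v') = u' *m z *m v' by rewrite !mulmxA.
  rewrite ltnS leq_eqVlt => /orP[/eqP|lt_t].
    by rewrite -Et => /position_inj[-> ->] []; rewrite zij0 eqxx.
  move=> bkl; apply: (nb k l lt_t); apply: blocked_eq bkl => a b ab.
  by apply: zE; rewrite Et (leq_ltn_trans ab).
case: bij => zij [[k ik zkj]|[l lj zil]].
  (* The pivot [(k, j)] comes earlier, hence is not blocked, so row [k] vanishes to its left. Adding
     a multiple of row [k] to row [i] therefore leaves the columns before [j] alone. *)
  have zk0 (l : 'I_m) : (l < j)%N -> z k l = 0.
    move=> lj; apply/eqP/negPn/negP => zkl; apply: (nb k j).
      by rewrite -Et position_lt eqxx ik orbT.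
    by split=> //; right; exists l.
  exists (1%:M + (- (z i j / z k j)) *: delta_mx i k), 1%:M.
  split; rewrite ?unip1 ?unip_transvection ?transvection_rowE //.
    by rewrite eqxx mul1r mulNr divfK // subrr.
  move=> a b; rewrite transvection_rowE position_lt.
  case: (a =P i) => [->|_ _]; last by rewrite mul0r addr0.
  by rewrite ltnn andbF orbF => /zk0 ->; rewrite !mulr0 addr0.
(* Dually, the pivot [(i, l)] has only zeros below it, so adding a multiple of column [l] to column
   [j] leaves the rows below [i] alone. *)
have zl0 (k : 'I_m) : (i < k)%N -> z k l = 0.
  move=> ik; apply/eqP/negPn/negP => zkl; apply: (nb i l).
    by rewrite -Et position_lt lj.
  by split=> //; left; exists k.
exists 1%:M, (1%:M + (- (z i j / z i l)) *: delta_mx l j).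
split; rewrite ?unip1 ?unip_transvection ?transvection_colE //.
  by rewrite eqxx mul1r mulNr divfK // subrr.
move=> a b; rewrite transvection_colE position_lt.
case: (b =P j) => [->|_ _]; last by rewrite mul0r addr0.
by rewrite ltnn /= => /zl0 ->; rewrite !mulr0 addr0.
Qed.

End Rook.

(** * Superclasses partition the type D group *)

Section Superclasses.
Variable F : finFieldType.
Local Notation unip := (unip F).
Local Notation Dpart := (Dpart F).

Lemma antidiag_flip n (A : 'M[F]_n) :
  antidiag F n *m A^T *m antidiag F n = flip A.
Proof.
apply/matrixP => i j; rewrite !mxE (bigD1 (rev_ord j)) //= big1 => [|k kj].
  rewrite !mxE rev_ordK eqxx mulr1 addr0 (bigD1 (rev_ord i)) //= big1 => [|k ki].
    by rewrite !mxE eqxx mul1r addr0.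
  by rewrite !mxE (negbTE ki) mul0r.
rewrite [antidiag F n _ _]mxE (_ : (j == rev_ord k) = false) ?mulr0 //.
by apply: contraNF kj => /eqP->; rewrite rev_ordK.
Qed.

Lemma rev_lshift n (i : 'I_n) : rev_ord (lshift n i) = rshift n (rev_ord i).
Proof. by apply: val_inj => /=; have := ltn_ord i; lia. Qed.

Lemma rev_rshift n (i : 'I_n) : rev_ord (rshift n i) = lshift n (rev_ord i).
Proof. by apply: val_inj => /=; have := ltn_ord i; lia. Qed.

Lemma flip_block n (A B C D : 'M[F]_n) :
  flip (block_mx A B C D) = block_mx (flip D) (flip B) (flip C) (flip A).
Proof.
apply/matrixP => i j; rewrite mxE.
case: (split_ordP i) => i' ->; case: (split_ordP j) => j' ->;
  by rewrite ?(rev_lshift, rev_rshift) ?(block_mxEul, block_mxEur, block_mxEdl, block_mxEdr) mxE.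
Qed.

Lemma unip_block n (A B C : 'M[F]_n) :
  A \in unip n -> C \in unip n -> block_mx A B 0 C \in unip (n + n).
Proof.
move=> /unipP hA /unipP hC; apply/unipP => i j.
case: (split_ordP i) => i' ->; case: (split_ordP j) => j' -> /= ji;
  rewrite ?(block_mxEul, block_mxEur, block_mxEdl, block_mxEdr) -val_eqE /=.
- by rewrite hA.
- by have := ltn_ord i'; lia.
- by rewrite mxE gtn_eqF // ltn_addr.
- by rewrite eqn_add2l hC // -(leq_add2l n).
Qed.

Lemma unip_submx n (x : 'M[F]_(n + n)) : x \in unip (n + n) ->
  [/\ ulsubmx x \in unip n, dlsubmx x = 0 & drsubmx x \in unip n].
Proof.
move=> /unipP hx; split.
- by apply/unipP => i j ji; rewrite !mxE hx // -val_eqE.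
- apply/matrixP => i j; rewrite !mxE hx /=; last by have := ltn_ord j; lia.
  by rewrite -val_eqE gtn_eqF //= ltn_addr.
- by apply/unipP => i j ji; rewrite !mxE hx ?leq_add2l // -val_eqE /= eqn_add2l.
Qed.

(** For a unipotent [x] with upper blocks [A], [B], the lower right block of [x *m flip x = 1] makes
    the last diagonal block of [x] equal to [flip] of the inverse of [A]; the upper right block says
    that [Q = invmx A *m B] satisfies [flip Q = - Q]. *)
Lemma UDP n (x : 'M[F]_(n + n)) :
  x \in UD F n <-> x \in unip (n + n) /\ x *m flip x = 1%:M.
Proof.
split=> [/imset2P[P Q hP]|[hx Ex]].
  rewrite inE !antidiag_flip => /eqP hQ ->; have uP := unip_unit hP.
  split; first by rewrite unip_block ?unip_flip ?unipV.
  have flip0 : flip (0 : 'M[F]_n) = 0 by apply/matrixP => i j; rewrite !mxE.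
  rewrite flip_block flipK flip0 mulmx_block !flipM hQ !mulmx0 !mul0mx addr0 !add0r.
  rewrite mulmxV // -flipM mulmxV // flip1.
  by rewrite mulNmx mulmxN mulmxA addNr -scalar_mx_block.
have [hA C0 _] := unip_submx hx; have uA := unip_unit hA.
move: Ex; rewrite -[x]submxK C0 flip_block mulmx_block.
rewrite (scalar_mx_block n n) => /eq_block_mx[_ E1 _].
rewrite !mul0mx add0r => E2.
apply/imset2P; exists (ulsubmx x) (invmx (ulsubmx x) *m ursubmx x) => //.
  rewrite inE antidiag_flip.
  have uf : flip (ulsubmx x) \in unitmx by apply/unip_unit/unip_flip.
  apply/eqP; apply: (can_inj (mulmxK uf)).
  rewrite -flipM mulKVmx // mulNmx; apply: (can_inj (mulKmx uA)).
  by rewrite mulmxN !mulmxA mulmxV // mul1mx; apply/eqP; rewrite -addr_eq0; apply/eqP.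
rewrite mulKVmx // antidiag_flip; congr (block_mx _ _ _ _).
rewrite -[LHS]mulmx1 -(flip1 _ n) -(mulVmx uA).
by rewrite flipM mulmxA E2 mul1mx.
Qed.

Lemma arc_mxE n (l : Dpart n) i j :
  arc_mx l i j = \sum_(a | (i, j, a) \in arcs l) a.
Proof.
rewrite summxE (bigID (fun t => t.1 == (i, j))) /= [X in _ + X]big1 ?addr0.
  rewrite (reindex_omap (fun a => (i, j, a)) (fun t : larc F n => Some t.2)) /=; last first.
    by case=> [[i' j'] a] /= /andP[_ /eqP[-> ->]].
  apply: eq_big => [a|a _]; first by rewrite !eqxx !andbT.
  by rewrite !mxE !eqxx mulr1.
case=> [[i' j'] a] /= /andP[_ nij]; rewrite !mxE.
rewrite (_ : _ && _ = false) ?mulr0 //.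
by apply: contraNF nij => /andP[/eqP-> /eqP->].
Qed.

Lemma arc_mx_arc n (l : Dpart n) i j a : (i, j, a) \in arcs l -> arc_mx l i j = a.
Proof.
move=> ija; rewrite arc_mxE (bigD1 a) //= big1 ?addr0 // => b /andP[ijb].
by rewrite (Dpart_label (arcsP l) ijb ija) eqxx.
Qed.

Lemma arc_mx_neq0 n (l : Dpart n) i j :
  arc_mx l i j != 0 -> (i, j, arc_mx l i j) \in arcs l.
Proof.
move=> nz; suff [a ija] : exists a, (i, j, a) \in arcs l by rewrite (arc_mx_arc ija).
apply: contrapT => H; move: nz; rewrite arc_mxE big1 ?eqxx // => a ija.
by case: H; exists a.
Qed.

Lemma arc_mx_inj n : injective (@arc_mx F n).
Proof.
suff sub (l mu : Dpart n) : arc_mx l = arc_mx mu -> arcs l \subset arcs mu.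
  move=> l mu E; apply: val_inj; apply/eqP; rewrite eqEsubset.
  by rewrite !sub.
move=> E; apply/subsetP => -[[i j] a] ija; have [_ _ a0] := Dpart_arc (arcsP l) ija.
rewrite -(arc_mx_arc ija) E; apply: arc_mx_neq0.
by rewrite -E (arc_mx_arc ija).
Qed.

(** Of two distinct arcs sharing a left or a right endpoint, one would end strictly inside the
    other, against [Dpart_noncover]. *)
Lemma arc_mx_rook n (l : Dpart n) : rook (arc_mx l).
Proof.
have [H1 _ _ H4] := arcsP l.
split=> [i j k /arc_mx_neq0 ij /arc_mx_neq0 ik|i j k /arc_mx_neq0 ik /arc_mx_neq0 jk];
  apply: val_inj => /=.
  have [? _ _] := H1 _ _ _ ij; have [? _ _] := H1 _ _ _ ik.
  case: (ltngtP j k) => // jk.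
    by case: (H4 _ _ _ j ik _ (arc_mx l i j)) => [|/negP]; first exact/andP.
  by case: (H4 _ _ _ k ij _ (arc_mx l i k)) => [|/negP]; first exact/andP.
have [? _ _] := H1 _ _ _ ik; have [? _ _] := H1 _ _ _ jk.
case: (ltngtP i j) => // ij.
  by case: (H4 _ _ _ j ik _ (arc_mx l j k)) => [|_ /negP]; first exact/andP.
by case: (H4 _ _ _ i jk _ (arc_mx l i k)) => [|_ /negP]; first exact/andP.
Qed.

Lemma arc_mx_flip n (l : Dpart n) : flip (arc_mx l) = - arc_mx l.
Proof.
have H i j : arc_mx l i j != 0 -> arc_mx l (rev_ord j) (rev_ord i) = - arc_mx l i j.
  by move=> /arc_mx_neq0/(Dpart_neg (arcsP l))/arc_mx_arc.
apply/matrixP => i j; rewrite !mxE.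
have [E|/H //] := eqVneq (arc_mx l i j) 0; rewrite E oppr0.
have [//|/H] := eqVneq (arc_mx l (rev_ord j) (rev_ord i)) 0.
by rewrite !rev_ordK E => /esym/eqP; rewrite oppr_eq0 => /eqP.
Qed.

Lemma arc_mx_upper n (l : Dpart n) : strict_upper (arc_mx l).
Proof.
move=> i j ji; apply/eqP/negPn/negP => /arc_mx_neq0/(Dpart_arc (arcsP l))[].
by rewrite ltnNge ji.
Qed.

(** A common element puts the two arc matrices in one double coset; both are rook, so [rook_unique]
    identifies them. *)
Lemma superclass_disjoint n (l mu : Dpart n) x :
  x \in superclass l -> x \in superclass mu -> l = mu.
Proof.
move=> /setIP[_ /imsetP[_ /imset2P[u v hu hv ->] ->]].
move=> /setIP[_ /imsetP[_ /imset2P[u' v' hu' hv' ->] /addIr E]].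
apply: arc_mx_inj; have E' : arc_mx l = invmx u *m u' *m arc_mx mu *m (v' *m invmx v).
  apply: (can_inj (mulKmx (unip_unit hu))); apply: (can_inj (mulmxK (unip_unit hv))).
  by rewrite E !mulmxA mulmxV ?unip_unit // mul1mx mulmxKV ?unip_unit.
rewrite E' rook_unique ?unipM ?unipV //; first exact: arc_mx_rook.
by rewrite -E'; exact: arc_mx_rook.
Qed.

Hypothesis two_neq0 : 2%:R != 0 :> F.
Local Notation half := (2%:R^-1 : F).

Lemma half2 (V : lmodType F) (x : V) : half *: x + half *: x = x.
Proof. by rewrite -scalerDl -(mulr2n half) -(mulr_natl half) divff // scale1r. Qed.

Lemma comm_mxZ n a (A B : 'M[F]_n) : comm_mx A B -> comm_mx A (a *: B).
Proof. by move=> AB; rewrite /comm_mx -scalemxAl -scalemxAr AB. Qed.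

(** The conditions on a D-partition match those on its matrix: skewness gives the arcs
    [(-j, -i, -a)], and the rook property gives the non-covering condition. *)
Lemma skew_rook_arc n (z : 'M[F]_(n + n)) : strict_upper z -> rook z ->
  flip z = - z -> exists l : Dpart n, arc_mx l = z.
Proof.
move=> zU [zR zC] zF.
have zE i j : z (rev_ord j) (rev_ord i) = - z i j.
  by have /matrixP/(_ i j) := zF; rewrite !mxE.
pose L : {set larc F n} := [set t | (t.2 != 0) && (z t.1.1 t.1.2 == t.2)].
have inL i j a : ((i, j, a) \in L) = (a != 0) && (z i j == a) by rewrite inE.
have nz i j a : (i, j, a) \in L -> z i j != 0 by rewrite inL => /andP[a0 /eqP->].
have DL : is_Dpart L.
  split=> [i j a ija|i j a b|i j a|i j a k /nz ija /andP[ik kj] b].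
  - have := nz _ _ _ ija => zij; split.
    + by rewrite ltnNge; apply: contra zij => /zU ->.
    (* An antidiagonal entry equals its own opposite, so it vanishes because 2 is invertible; this
       is the condition [j != -i]. *)
    + apply: contra zij => /eqP ->; have := zE i (rev_ord i).
      rewrite rev_ordK => /eqP; rewrite -subr_eq0 opprK -mulr2n -[_ *+ 2]mulr_natl.
      by rewrite mulf_eq0 (negbTE two_neq0).
    + by move: ija; rewrite inL => /andP[].
  - by rewrite !inL => /andP[_ /eqP<-] /andP[_ /eqP].
  - by rewrite !inL zE oppr_eq0 eqr_opp.
  - split; apply/negP => /nz H.
      by move: kj; rewrite (zR _ _ _ H ija) ltnn.
    by move: ik; rewrite (zC _ _ _ H ija) ltnn.
exists (MkDpart DL); apply/matrixP => i j.
have [zij|zij] := eqVneq (z i j) 0; last first.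
  by apply: arc_mx_arc; rewrite inL zij /=.
rewrite zij; apply/eqP/negPn/negP => H; have := arc_mx_neq0 H.
by move=> /nz; rewrite zij eqxx.
Qed.

(* Cayley transform: with w = (1 + x)/2 unipotent, y = (x - 1) w^-1 is skew. *)
Lemma superclass_cover n x : x \in UD F n -> exists l : Dpart n, x \in superclass l.
Proof.
move=> xD; have /UDP[hx Ex] := xD.
pose w := half *: (x + 1%:M).
have hw : w \in unip (n + n).
  apply/unipP => i j ji; rewrite !mxE (unipP _ hx) // mulrDr.
  exact: (@half2 F^o).
have uw := unip_unit hw.
pose y := (x - 1%:M) *m invmx w.
have Eyw : y *m w = x - 1%:M by rewrite mulmxKV.
have wx : w *m (x - 1%:M) = (x - 1%:M) *m w.
  apply/comm_mx_sym/comm_mxZ/comm_mxD; last exact: comm_mx1.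
  exact/comm_mx_sym/comm_mxB/comm_mx1.
have Ewy : w *m y = x - 1%:M by rewrite mulmxA wx mulmxK.
have yF : flip y = - y.
  (* Multiplying by [x], with [x *m flip w = w] and [x *m flip x = 1], turns this into
     [w *m flip y = 1 - x = - (w *m y)], and [w] cancels. *)
  have /(congr1 (mulmx x)) : flip w *m flip y = flip x - 1%:M.
    by rewrite -flipM Eyw flipD flipN flip1.
  rewrite mulmxA mulmxDr Ex mulmxN mulmx1.
  have -> : x *m flip w = w.
    by rewrite flipZ -scalemxAr flipD flip1 mulmxDr Ex mulmx1 addrC.
  by rewrite -opprB -Ewy -mulmxN; exact: (can_inj (mulKmx uw)).
have yU : strict_upper y.
  rewrite -[y]mul1mx mulmxA mul1mx.
  have H : strict_upper (x - 1%:M).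
    by move=> i j ji; rewrite !mxE (unipP _ hx) // subrr.
  rewrite -[x - _]mul1mx; apply: strict_upper_mul H; [exact: unip1|exact: unipV].
have [u [v [hu hv zR]]] := rook_exists y.
set z := u *m y *m v in zR.
have zU : strict_upper z by apply: strict_upper_mul.
have Ey : y = invmx u *m z *m invmx v.
  by rewrite /z !mulmxA mulVmx ?unip_unit // mul1mx mulmxK ?unip_unit.
(* Since [y] is skew, [flip z] and [- z] lie in the same double coset; both are rook, hence
   equal. *)
have zF : flip z = - z.
  have E : flip z = (flip v *m invmx u) *m (- z) *m (invmx v *m flip u).
    by rewrite {1}/z 2!flipM yF Ey !(mulmxN, mulNmx) !mulmxA.
  rewrite E rook_unique ?unipM ?unip_flip ?unipV //; first exact: rookN.
  by rewrite -E; exact: rook_flip.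
have [l El] := skew_rook_arc zU zR zF.
exists l; apply/setIP; split=> //; apply/imsetP; exists (x - 1%:M); last by rewrite subrK.
apply/imset2P; exists (invmx u) (invmx v *m w); rewrite ?unipM ?unipV //.
by rewrite El mulmxA -Ey Eyw.
Qed.

(** The inverse Cayley transform [(1 + y/2) (1 - y/2)^-1] of [y = arc_mx l] is a witness. As [y] is
    skew, [flip] exchanges the two commuting factors [1 + y/2] and [1 - y/2], so the quotient is
    orthogonal, and subtracting 1 leaves [y (1 - y/2)^-1], in the double coset of [y]. *)
Lemma superclass_neq0 n (l : Dpart n) : exists x, x \in superclass l.
Proof.
set y := arc_mx l; pose w := 1%:M - half *: y; pose w' := 1%:M + half *: y.
have yU : strict_upper y by exact: arc_mx_upper.
have hw : w \in unip (n + n).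
  by apply/unipP => i j ji; rewrite !mxE yU // mulr0 subr0.
have hw' : w' \in unip (n + n).
  by apply/unipP => i j ji; rewrite !mxE yU // mulr0 addr0.
have uw := unip_unit hw; have uw' := unip_unit hw'.
have fw : flip w' = w by rewrite flipD flip1 flipZ arc_mx_flip scalerN.
have ww : w' *m w = w *m w'.
  apply: comm_mxB; first exact: comm_mx1.
  by apply/comm_mxZ/comm_mx_sym/comm_mxD; [exact: comm_mx1|exact: comm_mxZ].
exists (w' *m invmx w); apply/setIP; split.
  apply/UDP; split; first by rewrite unipM ?unipV.
  have fV : flip (invmx w) = invmx w'.
    apply: (can_inj (mulmxK uw')); rewrite mulVmx //.
    have -> : w' = flip w by rewrite -fw flipK.
    by rewrite -flipM mulmxV // flip1.
  have -> : flip (w' *m invmx w) = w *m invmx w'.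
    rewrite flipM fw fV; apply: (can_inj (mulKmx uw')).
    by rewrite mulKVmx // mulmxA ww mulmxK.
  by rewrite -!mulmxA (mulKmx uw) mulmxV.
apply/imsetP; exists (y *m invmx w); last first.
  rewrite -[X in _ + X](mulmxV uw) -mulmxDl; congr (_ *m _).
  by rewrite /w /w' -{2}[y]half2 addrCA addrK.
by apply/imset2P; exists 1%:M (invmx w); rewrite ?unip1 ?unipV // mul1mx.
Qed.

End Superclasses.
(** * The P-basis *)

Section Linear.
Variables (K : fieldType) (V W : lmodType K) (f : V -> W).
Hypothesis fL : linear f.

Lemma linear_fun0 : f 0 = 0.
Proof. by have := fL (-1) 0 0; rewrite !scaleN1r oppr0 add0r addNr. Qed.

Lemma linear_funD x y : f (x + y) = f x + f y.
Proof. by have := fL 1 x y; rewrite !scale1r. Qed.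

Lemma linear_funZ a x : f (a *: x) = a *: f x.
Proof. by have := fL a x 0; rewrite !addr0 linear_fun0 addr0. Qed.

Lemma linear_fun_sum I r (P : pred I) F :
  f (\sum_(i <- r | P i) F i) = \sum_(i <- r | P i) f (F i).
Proof. exact: (big_morph f linear_funD linear_fun0). Qed.

Lemma linear_funB x y : f (x - y) = f x - f y.
Proof. by rewrite -scaleN1r addrC fL scaleN1r addrC. Qed.

End Linear.

(** Recursion along the measure [h]: iterating [Phi] from a constant function, the value at [x] no
    longer changes after [h x + 1] rounds. It serves for inversion over the inclusion order and for
    convolution inverses. *)
Lemma measure_fixpoint (T M : Type) (h : T -> nat) (Phi : (T -> M) -> T -> M) :
  inhabited M ->
  (forall s s' x, (forall y, (h y < h x)%N -> s y = s' y) -> Phi s x = Phi s' x) ->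
  exists s, forall x, s x = Phi s x.
Proof.
move=> [m0] HPhi; pose S N := iter N Phi (fun=> m0).
have SE N x : (h x < N)%N -> S N x = S (h x).+1 x.
  elim: N {-2}N (leqnn N) x => [|B IH] [|N] // NB x; rewrite ltnS => xN /=.
  by apply: HPhi => y yx; rewrite (IH N) ?(leq_trans yx) // (IH (h x)) // (leq_trans xN).
exists (fun x => S (h x).+1 x) => x /=.
by apply: HPhi => y yx; rewrite -/(S (h x)) SE.
Qed.

Section PBasis.
Variables (F : finFieldType) (C : fieldType).
Hypothesis two_neq0 : 2%:R != 0 :> F.
Local Notation Dpart := (Dpart F).
Local Notation SC := (SC F C).
Local Notation SCn := (SCn F C).

Fact rep_subproof n (l : Dpart n) : exists x : UDtype F n, val x \in superclass l.
Proof.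
have [x xl] := superclass_neq0 two_neq0 l.
have xD : x \in UD F n by case/setIP: xl.
by exists (exist _ x xD).
Qed.

Definition rep n (l : Dpart n) : UDtype F n := xchoose (rep_subproof l).

Lemma repP n (l : Dpart n) : val (rep l) \in superclass l.
Proof. exact: (xchooseP (rep_subproof l)). Qed.

Lemma kappa_rep n (l mu : Dpart n) : scfun (kappa C l) (rep mu) = (l == mu)%:R.
Proof.
rewrite ffunE; congr (_%:R : C); congr nat_of_bool; apply/idP/eqP => [H|->]; last exact: repP.
exact: superclass_disjoint H (repP mu).
Qed.

Lemma scfun_sum n I r (P : pred I) (f : I -> SCn n) x :
  scfun (\sum_(i <- r | P i) f i) x = \sum_(i <- r | P i) scfun (f i) x.
Proof.
apply: (big_morph (fun f : SCn n => scfun f x)) => [f' g|];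
  by rewrite ?ffunE //= ffunE.
Qed.

(** The superclasses cover the group and are disjoint, so at each point exactly one term
    survives. *)
Lemma scfun_kappa n (f : SCn n) : f = \sum_l (scfun f (rep l) : C) *: kappa C l.
Proof.
apply: val_inj; apply/ffunP => x.
have [l xl] := superclass_cover two_neq0 (valP x).
have -> : scfun f x = scfun f (rep l).
  by apply: (is_scfunP _ (valP f) l) => //; exact: repP.
rewrite scfun_sum (bigD1 l) //= big1 => [|mu mul].
  by rewrite !ffunE xl addr0 [_ *: _]mulr1.
rewrite !ffunE (_ : _ \in _ = false) ?[_ *: _]mulr0 //.
by apply: contraNF mul => H; rewrite (superclass_disjoint H xl).
Qed.

Lemma SC_eqP (f g : SC) : (forall k, dsum_val f k = dsum_val g k) -> f = g.
Proof. by move=> fg; apply: val_inj; apply: functional_extensionality_dep; exact: fg. Qed.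

Lemma scinj_in n (f : SCn n) : dsum_val (scinj f) n = f.
Proof. exact: dfwith_in. Qed.

Lemma scinj_out n (f : SCn n) k : n != k -> dsum_val (scinj f) k = 0.
Proof. by move=> nk; apply: dfwith_out. Qed.

Lemma scinj_linear n : linear (@scinj F C n).
Proof.
move=> a f g; apply: SC_eqP => k.
rewrite -[RHS]/(a *: dsum_val (scinj f) k + dsum_val (scinj g) k).
have [<-|nk] := eqVneq n k; first by rewrite !scinj_in.
by rewrite !scinj_out // scaler0 addr0.
Qed.

Lemma dsum_val_sum I r (P : pred I) (f : I -> SC) k :
  dsum_val (\sum_(i <- r | P i) f i) k = \sum_(i <- r | P i) dsum_val (f i) k.
Proof. exact: (big_morph (fun f : SC => dsum_val f k)). Qed.

Lemma SC_bound (f : SC) : exists N, forall n, (N <= n)%N -> dsum_val f n = 0.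
Proof. by apply/asboolP; case: f. Qed.

Lemma SC_sum (f : SC) N : (forall n, (N <= n)%N -> dsum_val f n = 0) ->
  f = \sum_(n < N) scinj (dsum_val f n).
Proof.
move=> fN; apply: SC_eqP => k.
rewrite dsum_val_sum; have [Nk|kN] := leqP N k.
  rewrite fN // big1 // => i _; rewrite scinj_out //.
  by rewrite neq_ltn (leq_trans (ltn_ord i)).
rewrite (bigD1 (Ordinal kN)) // scinj_in big1 => [|i ik]; first by rewrite /= addr0.
by rewrite scinj_out.
Qed.

(** Recursions over the inclusion order go from larger D-partitions to smaller ones; their measure
    is the number of labelled arcs left out. *)
Lemma larc_card_lt n (l mu : Dpart n) : arcs l \subset arcs mu -> mu != l ->
  (#|{: larc F n}| - #|arcs mu| < #|{: larc F n}| - #|arcs l|)%N.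
Proof.
move=> lmu mul; have lt_card : (#|arcs l| < #|arcs mu|)%N.
  apply: proper_card; rewrite properEneq lmu andbT eq_sym.
  by apply: contra mul => /eqP E; apply/eqP/val_inj.
by rewrite ltn_sub2l // (leq_trans lt_card) ?max_card.
Qed.

(** This is the spanning property of the [P]s: each [kappa] is its [P] minus the [kappa]s of
    strictly larger D-partitions, which are handled first. *)
Lemma SC_ind (Q : SC -> Prop) : (forall a f g, Q f -> Q g -> Q (a *: f + g)) ->
  Q 0 -> (forall n (l : Dpart n), Q (Pbasis C l)) -> forall f, Q f.
Proof.
move=> QL Q0 QP.
have QS I r (P : pred I) (f : I -> SC) : (forall i, P i -> Q (f i)) ->
    Q (\sum_(i <- r | P i) f i).
  move=> Qf; elim/big_ind: _ => // x y; rewrite -{2}[x]scale1r; exact: QL.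
have QZ a f : Q f -> Q (a *: f) by move=> Qf; rewrite -[_ *: _]addr0; apply: QL.
have Qk n (l : Dpart n) : Q (scinj (kappa C l)).
  have [d] := ubnP (#|{: larc F n}| - #|arcs l|); elim: d l => // d IH l le_d.
  have -> : scinj (kappa C l) = Pbasis C l
      - scinj (\sum_(mu : Dpart n | (arcs l \subset arcs mu) && (mu != l)) kappa C mu).
    rewrite /Pbasis (bigD1 l) //= -(linear_funB (@scinj_linear n)).
    by rewrite addrK.
  rewrite addrC -scaleN1r; apply: QL; last exact: QP.
  rewrite (linear_fun_sum (@scinj_linear n)); apply: QS => mu /andP[lmu mul].
  by apply: IH; rewrite (leq_trans (larc_card_lt lmu mul)).
move=> f; have [N fN] := SC_bound f; rewrite (SC_sum fN); apply: (QS) => i _.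
rewrite [dsum_val f i]scfun_kappa (linear_fun_sum (@scinj_linear i)); apply: QS => l _.
by rewrite (linear_funZ (@scinj_linear i)); exact: QZ.
Qed.

Section Extend.
Variables (M : lmodType C) (g : forall n, Dpart n -> M).

(** A linear map with value [g] on the [P]s must have values [s] on the [kappa]s solving this
    triangular system; it is solved from the largest D-partitions downwards. *)
Lemma moebius_exists : exists s : forall n, Dpart n -> M,
  forall n (l : Dpart n), g l = \sum_(mu : Dpart n | arcs l \subset arcs mu) s n mu.
Proof.
have H n : exists s : Dpart n -> M, forall l,
    g l = \sum_(mu : Dpart n | arcs l \subset arcs mu) s mu.
  have [|s s' l ss'|s sE] := @measure_fixpoint (Dpart n) M
    (fun l => #|{: larc F n}| - #|arcs l|)%N (fun s l =>
     g l - \sum_(mu : Dpart n | (arcs l \subset arcs mu) && (mu != l)) s mu).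
  - by split; exact: 0.
  - by congr (_ - _); apply: eq_bigr => mu /andP[lmu mul]; apply: ss'; exact: larc_card_lt.
  - by exists s => l; rewrite (bigD1 l) //= sE subrK.
by exists (fun n => projT1 (cid (H n))) => n; exact: (projT2 (cid (H n))).
Qed.

Definition moebius : forall n, Dpart n -> M := projT1 (cid moebius_exists).

Lemma moebiusE n (l : Dpart n) :
  g l = \sum_(mu : Dpart n | arcs l \subset arcs mu) moebius mu.
Proof. exact: (projT2 (cid moebius_exists)). Qed.

Definition Pextend_n n (f : SCn n) : M := \sum_l (scfun f (rep l) : C) *: moebius l.

Definition Pextend (f : SC) : M :=
  \sum_(n < projT1 (cid (SC_bound f))) Pextend_n (dsum_val f n).

Lemma Pextend_n0 n : Pextend_n (0 : SCn n) = 0.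
Proof. by rewrite /Pextend_n big1 // => l _; rewrite ffunE scale0r. Qed.

(** The bound inside [Pextend] is an arbitrary choice; any other valid bound only adds or drops zero
    terms. This allows one common bound in the proof of linearity. *)
Lemma PextendE f N : (forall n, (N <= n)%N -> dsum_val f n = 0) ->
  Pextend f = \sum_(n < N) Pextend_n (dsum_val f n).
Proof.
have H A B : (A <= B)%N -> (forall n, (A <= n)%N -> dsum_val f n = 0) ->
    \sum_(n < B) Pextend_n (dsum_val f n) = \sum_(n < A) Pextend_n (dsum_val f n).
  move=> AB fA; rewrite (big_ord_widen B (fun n => Pextend_n (dsum_val f n)) AB).
  rewrite [RHS]big_mkcond; apply: eq_bigr => i _; case: ltnP => // Ai.
  by rewrite fA ?Pextend_n0.
move=> fN; rewrite /Pextend; case: cid => N' /= fN'.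
by case: (leqP N N') => [/H->//|/ltnW/H ->].
Qed.

Lemma Pextend_linear : linear Pextend.
Proof.
move=> a f h; have [A fA] := SC_bound f; have [B hB] := SC_bound h.
rewrite !(@PextendE _ (maxn A B)) => [| n| n| n]; rewrite ?geq_max.
- rewrite scaler_sumr -big_split; apply: eq_bigr => n _ /=.
  rewrite /Pextend_n scaler_sumr -big_split; apply: eq_bigr => l _ /=.
  by rewrite !ffunE scalerDl scalerA.
- by case/andP=> _; exact: hB.
- by case/andP=> + _; exact: fA.
- case/andP=> An Bn; rewrite -[LHS]/(a *: dsum_val f n + dsum_val h n).
  by rewrite fA // hB // scaler0 addr0.
Qed.

(** Linear independence of the [P]s in usable form: arbitrary values on them are attained by a
    linear map. *)
Lemma PextendP n (l : Dpart n) : Pextend (Pbasis C l) = g l.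
Proof.
rewrite (@PextendE _ n.+1) => [|k nk]; last by rewrite scinj_out // neq_ltn nk.
rewrite big_ord_recr scinj_in big1 => [|i _]; last first.
  by rewrite scinj_out ?Pextend_n0 // neq_ltn /= ltn_ord orbT.
rewrite /= add0r /Pextend_n moebiusE [RHS]big_mkcond; apply: eq_bigr => mu _.
rewrite scfun_sum big_mkcond (bigD1 mu) //= kappa_rep eqxx big1 ?addr0.
  by case: ifP; rewrite ?scale1r ?scale0r.
by move=> nu numu; rewrite kappa_rep (negbTE numu) if_same.
Qed.

End Extend.

Lemma Pbasis_ext (M : lmodType C) (f g : SC -> M) : linear f -> linear g ->
  (forall n (l : Dpart n), f (Pbasis C l) = g (Pbasis C l)) -> f =1 g.
Proof.
move=> fL gL fg; apply: SC_ind => [a x y fx fy||//]; first by rewrite fL gL fx fy.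
by rewrite !linear_fun0.
Qed.

End PBasis.
(** * Restriction of D-partitions *)

Section Pull.
Variable F : finFieldType.
Local Notation Dpart := (Dpart F).

Definition increasing m n (f : 'I_m -> 'I_n) : Prop := {homo f : i j / (i < j)%N}.

Lemma increasing_inj m n (f : 'I_m -> 'I_n) : increasing f -> injective f.
Proof.
by move=> fi i j E; apply: val_inj; case: (ltngtP i j) => // /fi; rewrite E ltnn.
Qed.

Lemma increasing_comp m n k (f : 'I_n -> 'I_k) (g : 'I_m -> 'I_n) :
  increasing f -> increasing g -> increasing (f \o g).
Proof. by move=> fi gi i j /gi/fi. Qed.

Lemma imset_set_comp (T U V : finType) (f : U -> V) (g : T -> U) (A : {set T}) :
  f @: (g @: A) = (f \o g) @: A.
Proof. exact: esym (imset_comp f g A). Qed.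

Lemma increasing_lshift m n : increasing (@lshift m n).
Proof. by []. Qed.

Lemma increasing_rshift m n : increasing (@rshift m n).
Proof. by move=> i j ij; rewrite /= ltn_add2l. Qed.

Lemma ord_pmP n (x : 'I_(n + n)) :
  exists i, x = lshift n i \/ x = rev_ord (lshift n i).
Proof.
case: (split_ordP x) => i ->; first by exists i; left.
by exists (rev_ord i); right; rewrite rev_lshift rev_ordK.
Qed.

Lemma relabel_comp m n k (f : 'I_n -> 'I_k) (g : 'I_m -> 'I_n) x :
  relabel f (relabel g x) = relabel (f \o g) x.
Proof.
by have [i [->|->]] := ord_pmP x; rewrite ?relabel_neg !relabel_pos.
Qed.

Lemma relabel_id n (x : 'I_(n + n)) : relabel id x = x.
Proof.
by have [i [->|->]] := ord_pmP x; rewrite ?relabel_neg !relabel_pos.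
Qed.

Lemma pm_lshift n (A : {set 'I_n}) i : (lshift n i \in pm A) = (i \in A).
Proof.
rewrite inE mem_imset; last exact: lshift_inj.
rewrite [X in _ || X](_ : _ = false) ?orbF //; apply/negP => /imsetP[j _].
by move=> /(congr1 val) /=; have := ltn_ord i; have := ltn_ord j; lia.
Qed.

Lemma pmC n (A : {set 'I_n}) x : (x \in pm (~: A)) = (x \notin pm A).
Proof. by have [i [->|->]] := ord_pmP x; rewrite ?pm_neg !pm_lshift inE. Qed.

Lemma pmU n (A B : {set 'I_n}) x : (x \in pm (A :|: B)) = (x \in pm A) || (x \in pm B).
Proof. by have [i [->|->]] := ord_pmP x; rewrite ?pm_neg !pm_lshift inE. Qed.

Lemma pmI n (A B : {set 'I_n}) x : (x \in pm (A :&: B)) = (x \in pm A) && (x \in pm B).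
Proof. by have [i [->|->]] := ord_pmP x; rewrite ?pm_neg !pm_lshift inE. Qed.

Lemma pm_relabel m n (f : 'I_m -> 'I_n) (A : {set 'I_m}) x :
  increasing f -> (relabel f x \in pm (f @: A)) = (x \in pm A).
Proof.
move=> fi; have [i [->|->]] := ord_pmP x; rewrite ?relabel_neg ?relabel_pos ?pm_neg !pm_lshift;
  by rewrite mem_imset //; exact: increasing_inj.
Qed.

Lemma pm_image m n (f : 'I_m -> 'I_n) x :
  increasing f -> relabel f x \in pm (f @: setT).
Proof.
by move/pm_relabel->; have [i [->|->]] := ord_pmP x; rewrite ?pm_neg pm_lshift inE.
Qed.

Lemma pm_imset m n (f : 'I_m -> 'I_n) (A : {set 'I_m}) x :
  x \in pm (f @: A) -> exists2 y, x = relabel f y & y \in pm A.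
Proof.
have [i [->|->]] := ord_pmP x; rewrite ?pm_neg pm_lshift => /imsetP[j jA ->].
  by exists (lshift m j); rewrite ?relabel_pos ?pm_lshift.
by exists (rev_ord (lshift m j)); rewrite ?relabel_neg ?relabel_pos ?pm_neg ?pm_lshift.
Qed.

Lemma in_restr n (A : {set 'I_n}) (l : Dpart n) x y a : ((x, y, a) \in restr A l) =
  [&& (x, y, a) \in arcs l, x \in pm A & y \in pm A].
Proof. exact: in_set. Qed.

(** An arc is lost by both restrictions exactly when it joins the two sides. *)
Lemma splitsP n (A : {set 'I_n}) (l : Dpart n) :
  reflect (forall x y a, (x, y, a) \in arcs l -> (x \in pm A) = (y \in pm A))
          (splits A l).
Proof.
apply: (iffP eqP) => [E x y a|H].
  rewrite E in_setU !in_restr !pmC.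
  by case/orP=> /and3P[_ ] => [-> ->|/negbTE-> /negbTE->].
apply/setP => -[[x y] a]; rewrite in_setU !in_restr !pmC.
by case: (boolP (_ \in arcs l)) => // /H ->; case: (y \in pm A).
Qed.

Definition pull_arcs m n (f : 'I_m -> 'I_n) (L : {set larc F n}) : {set larc F m} :=
  [set t | (relabel f t.1.1, relabel f t.1.2, t.2) \in L].

Lemma pull_arcs_Dpart m n (f : 'I_m -> 'I_n) (l : Dpart n) :
  increasing f -> is_Dpart (pull_arcs f (arcs l)).
Proof.
move=> fi; have [H1 H2 H3 H4] := arcsP l; have ri := relabel_inj fi.
split=> [i j a|i j a b|i j a|i j a k]; rewrite !inE /=.
- case/H1 => ij ji a0; split=> //; first by rewrite -(relabel_lt fi).
  by apply: contra ji => /eqP->; rewrite relabel_neg.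
- exact: H2.
- by move/H3; rewrite !relabel_neg.
- by move=> H ikj b; rewrite !inE /=; apply: H4 H _ _; rewrite !relabel_lt.
Qed.

(* For increasing f, the D-partition induced on the image of f; junk otherwise. *)
Definition pull m n (f : 'I_m -> 'I_n) (l : Dpart n) : Dpart m :=
  insubd (Dpart0 F m) (pull_arcs f (arcs l)).

Lemma in_pull m n (f : 'I_m -> 'I_n) (l : Dpart n) i j a : increasing f ->
  ((i, j, a) \in arcs (pull f l)) = ((relabel f i, relabel f j, a) \in arcs l).
Proof.
move=> fi; rewrite /arcs /pull val_insubd asboolT; last exact: pull_arcs_Dpart.
by rewrite inE.
Qed.

Lemma Dpart_eqP n (l mu : Dpart n) : arcs l =i arcs mu -> l = mu.
Proof. by move/setP/val_inj. Qed.

Lemma pull_comp m n k (f : 'I_n -> 'I_k) (g : 'I_m -> 'I_n) l :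
  increasing f -> increasing g -> pull g (pull f l) = pull (f \o g) l.
Proof.
move=> fi gi; apply: Dpart_eqP => -[[i j] a].
by rewrite !in_pull ?relabel_comp //; exact: increasing_comp.
Qed.

Lemma pull_id n (l : Dpart n) : pull id l = l.
Proof. by apply: Dpart_eqP => -[[i j] a]; rewrite in_pull // !relabel_id. Qed.

(** The points of [pm A] below [relabel f i] are the images of the points below [i], and there are
    [i] of those. *)
Lemma st_relabel m n (A : {set 'I_n}) (f : 'I_m -> 'I_n) i :
  increasing f -> A = f @: setT -> st A (relabel f i) = i.
Proof.
move=> fi EA; rewrite /st.
have -> : [set y in pm A | (y < relabel f i)%N] = relabel f @: [set y : 'I_(m + m) | (y < i)%N].
  apply/setP => y; rewrite inE; apply/andP/imsetP => [[]|[z]].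
    by rewrite EA => /pm_imset[z -> _]; rewrite relabel_lt // => zi; exists z; rewrite ?inE.
  by rewrite inE => zi ->; rewrite EA pm_image ?relabel_lt.
rewrite card_imset; last exact: relabel_inj.
have -> : [set y : 'I_(m + m) | (y < i)%N] = widen_ord (ltnW (ltn_ord i)) @: setT.
  apply/setP => y; rewrite inE; apply/idP/imsetP => [yi|[j _ ->]]; last exact: (ltn_ord j).
  by exists (Ordinal yi) => //; exact: val_inj.
by rewrite card_imset ?cardsT ?card_ord //; move=> j k /(congr1 val) /= E; exact: val_inj.
Qed.

(** Replaces counting positions by pulling back along an increasing enumeration of [A]; unlike [st],
    such pullbacks compose by [pull_comp]. *)
Lemma std_pull n (A : {set 'I_n}) (f : 'I_#|A| -> 'I_n) (l : Dpart n) :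
  increasing f -> A = f @: setT -> std A l = pull f l.
Proof.
move=> fi EA; apply: Dpart_eqP => -[[i j] a].
have inA x : relabel f x \in pm A by have := pm_image x fi; rewrite -EA.
rewrite in_pull //; apply/std_arcsP/idP => [[x [y [xA yA ix jy xy]]]|H]; last first.
  by exists (relabel f i), (relabel f j); rewrite !inA !(st_relabel _ fi EA).
have <- : x = relabel f i by apply: (@st_inj _ A) => //; rewrite (st_relabel _ fi EA).
suff <- : y = relabel f j by [].
by apply: (@st_inj _ A) => //; rewrite (st_relabel _ fi EA).
Qed.

Lemma increasing_exists n (A : {set 'I_n}) :
  exists f : 'I_#|A| -> 'I_n, increasing f /\ A = f @: setT.
Proof.
exists (@enum_val _ (mem A)); split; last first.
  apply/setP => x; apply/idP/imsetP => [xA|[i _ ->]]; last exact: enum_valP.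
  by exists (enum_rank_in xA x); rewrite ?enum_rankK_in.
move=> i j ij; pose x0 := enum_val i.
rewrite (enum_val_nth x0 i) (enum_val_nth x0 j).
have srt : sorted (fun x y : 'I_n => (x < y)%N) (enum A).
  rewrite /enum_mem -enumT; apply: sorted_filter => [x y z|]; first exact: ltn_trans.
  by have := iota_ltn_sorted 0 n; rewrite -val_enum_ord sorted_map.
by apply: (sorted_ltn_nth _ _ srt) => //; rewrite ?inE -?cardE //; exact: ltn_trans.
Qed.

(** D-partitions of all sizes in one type: standardizations live over [#|A|], and the sizes to be
    compared are often equal without being convertible. *)
Definition dpart : Type := {n & Dpart n}.

Definition restriction n (l : Dpart n) (A : {set 'I_n}) : dpart := Tagged Dpart (std A l).

Lemma restriction_pull m n (f : 'I_m -> 'I_n) (l : Dpart n) :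
  increasing f -> restriction l (f @: setT) = Tagged Dpart (pull f l).
Proof.
move=> fi; set A := f @: setT.
have EA : A = f @: setT by [].
have cA : #|A| = m by rewrite card_imset ?cardsT ?card_ord //; exact: increasing_inj.
(* With [A] opaque, [m] can be replaced by [#|A|], which gives [f] the type that [std_pull]
   expects. *)
clearbody A; case: m / cA f fi EA => f fi EA.
by rewrite /restriction (std_pull l fi EA).
Qed.

Lemma restriction_of_pull m n (f : 'I_m -> 'I_n) (l : Dpart n) (A : {set 'I_m}) :
  increasing f -> restriction (pull f l) A = restriction l (f @: A).
Proof.
move=> fi; have [g [gi EA]] := increasing_exists A.
rewrite {1}/restriction (std_pull _ gi EA) pull_comp //.
have -> : f @: A = (f \o g) @: setT by rewrite -(imset_set_comp f g) -EA.
by rewrite restriction_pull //; exact: increasing_comp.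
Qed.

(** As no arc leaves the image of [f], an arc is either seen by the pullback or has both ends
    outside the image, hence outside [f @: A]. *)
Lemma splits_pull m n (f : 'I_m -> 'I_n) (l : Dpart n) (A : {set 'I_m}) :
  increasing f -> splits (f @: setT) l -> splits A (pull f l) = splits (f @: A) l.
Proof.
move=> fi /splitsP sT; apply/splitsP/splitsP => H x y a.
  move=> xya; case: (boolP (x \in pm (f @: setT))) => xT.
    have yT := xT; rewrite (sT _ _ _ xya) in yT.
    have [x' Ex _] := pm_imset xT; have [y' Ey _] := pm_imset yT.
    by rewrite Ex Ey !pm_relabel //; apply: (H _ _ a); rewrite in_pull // -Ex -Ey.
  have yT := xT; rewrite (sT _ _ _ xya) in yT.
  have sub z : z \notin pm (f @: setT) -> z \in pm (f @: A) = false.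
    by apply: contraNF => /pm_imset[z' -> _]; exact: pm_image.
  by rewrite !sub.
by rewrite in_pull // => /H; rewrite !pm_relabel.
Qed.

Lemma pmD n (A B : {set 'I_n}) x : (x \in pm (A :\: B)) = (x \in pm A) && (x \notin pm B).
Proof. by rewrite setDE pmI pmC. Qed.

Lemma splitsC n (A : {set 'I_n}) (l : Dpart n) : splits (~: A) l = splits A l.
Proof. by rewrite /splits setCK setUC. Qed.

Lemma splitsU n (A B : {set 'I_n}) (l : Dpart n) :
  splits A l -> splits B l -> splits (A :|: B) l.
Proof.
by move=> /splitsP sA /splitsP sB; apply/splitsP => x y a H; rewrite !pmU (sA _ _ _ H) (sB _ _ _ H).
Qed.

Lemma splitsD n (A B : {set 'I_n}) (l : Dpart n) :
  splits A l -> splits B l -> splits (A :\: B) l.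
Proof.
by move=> /splitsP sA /splitsP sB; apply/splitsP => x y a H; rewrite !pmD (sA _ _ _ H) (sB _ _ _ H).
Qed.

Lemma splits0 n (l : Dpart n) : splits set0 l.
Proof.
by apply/splitsP => x y a _; have [i [->|->]] := ord_pmP x; have [j [->|->]] := ord_pmP y;
  rewrite ?pm_neg !pm_lshift !inE.
Qed.

Lemma splitsT n (l : Dpart n) : splits setT l.
Proof. by rewrite -setC0 splitsC splits0. Qed.

(** * Iterated sums over splitting sets *)

Section Sums.
Variable M : zmodType.

(** The increasing enumeration of [A] identifies subsets of the standardized ground set with subsets
    of [A], and complements there with complements in [A]. *)
Lemma sum_splits_std n (l : Dpart n) (A : {set 'I_n}) (phi : dpart -> dpart -> M) :
  splits A l ->
  \sum_(B | splits B (std A l)) phi (restriction (std A l) B) (restriction (std A l) (~: B))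
  = \sum_(B : {set 'I_n} | (B \subset A) && splits B l)
      phi (restriction l B) (restriction l (A :\: B)).
Proof.
move=> sA; have [f [fi EA]] := increasing_exists A.
have finj := increasing_inj fi.
have fA x : f x \in A by have : f x \in f @: setT; [exact: imset_f|rewrite -EA].
have Af y : y \in A -> exists x, y = f x.
  move=> yA; have : y \in f @: setT by rewrite -EA.
  by case/imsetP=> x _ ->; exists x.
rewrite (std_pull l fi EA) [RHS](reindex_onto (fun B : {set 'I_#|A|} => f @: B)
  (fun B : {set 'I_n} => f @^-1: B)) /=.
  apply: eq_big => [B|B _].
    rewrite splits_pull -?EA // (_ : f @: B \subset A) /=; last first.
      by apply/subsetP => _ /imsetP[x _ ->].
    rewrite (_ : f @^-1: _ == B) ?andbT //.
    by apply/eqP/setP => x; rewrite inE mem_imset.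
  rewrite !restriction_of_pull //; congr (phi _ (restriction _ _)).
  apply/setP => x; rewrite inE; apply/imsetP/andP => [[y yB ->]|[xB /Af[y Ex]]].
    by rewrite mem_imset // fA; move: yB; rewrite inE.
  by exists y => //; rewrite inE; apply: contra xB => yB; rewrite Ex imset_f.
move=> B /andP[BA _]; apply/setP => x; apply/imsetP/idP => [[y] + ->|xB].
  by rewrite inE.
by have /Af[y Ex] := subsetP BA _ xB; exists y; rewrite // inE -Ex.
Qed.

(** Both sides run over the ordered decompositions of the ground set into three blocks that no arc
    leaves. It yields both coassociativity and associativity of convolution. *)
Lemma sum_splits_assoc n (l : Dpart n) (h : dpart -> dpart -> dpart -> M) :
  \sum_(A | splits A l) \sum_(B | splits B (std A l))
     h (restriction (std A l) B) (restriction (std A l) (~: B)) (restriction l (~: A))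
  = \sum_(A | splits A l) \sum_(B | splits B (std (~: A) l))
     h (restriction l A) (restriction (std (~: A) l) B) (restriction (std (~: A) l) (~: B)).
Proof.
under eq_bigr => A sA do
  rewrite (sum_splits_std (fun b c => h b c (restriction l (~: A))) sA).
under [RHS]eq_bigr => A sA.
  rewrite (sum_splits_std (h (restriction l A))); last by rewrite splitsC.
  over.
rewrite (exchange_big_dep (fun B : {set 'I_n} => splits B l)) => [|A B _ /andP[]] //=.
apply: eq_bigr => B sB.
(* [B] is the first block and [C = A :\: B] the second, chosen on the right-hand side inside the
   complement of [B]. *)
rewrite (reindex_onto (fun C => B :|: C) (fun A => A :\: B)) /=; last first.
  by move=> A /and3P[_ BA _]; rewrite -[RHS](setID A B) (setIidPr BA).
apply: eq_big => [C|C]; last first.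
  case/andP=> _ /eqP EC; rewrite EC; congr (h _ _ (restriction _ _)).
  by rewrite setCU setDE.
rewrite subsetUl sB !andbT setDUl setDv set0U.
have -> : (C :\: B == C) = (C \subset ~: B).
  by rewrite setDE; apply/eqP/idP => [<-|/setIidPl //]; exact: subsetIr.
rewrite andbC; case: (boolP (C \subset _)) => //= CB.
apply/idP/idP => [sBC|sC]; last exact: splitsU.
have -> : C = (B :|: C) :\: B.
  by rewrite setDUl setDv set0U setDE; apply/esym/setIidPl.
exact: splitsD.
Qed.

End Sums.
End Pull.
(** * Shifted union *)

Section ShiftUnion.
Variable F : finFieldType.
Local Notation Dpart := (Dpart F).
Local Notation dpart := (dpart F).

Lemma in_shift_union k l (mu : Dpart k) (nu : Dpart l) t :
  (t \in arcs (shift_union mu nu)) = (t \in relabel_arcs (@lshift k l) (arcs mu))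
                                  || (t \in relabel_arcs (@rshift k l) (arcs nu)).
Proof. exact: in_setU. Qed.

Lemma mem_relabel_arcs l n (f : 'I_l -> 'I_n) (A : {set larc F l}) i j a :
  increasing f ->
  ((relabel f i, relabel f j, a) \in relabel_arcs f A) = ((i, j, a) \in A).
Proof.
move=> fi; have ri := relabel_inj fi; apply/imsetP/idP => [|H]; last by exists (i, j, a).
by case=> -[[x y] b] xyb [/ri-> /ri-> ->].
Qed.

Lemma pull_lshift k l (mu : Dpart k) (nu : Dpart l) :
  pull (@lshift k l) (shift_union mu nu) = mu.
Proof.
apply: Dpart_eqP => -[[i j] a]; rewrite in_pull // in_shift_union mem_relabel_arcs //.
rewrite [X in _ || X](_ : _ = false) ?orbF //; apply/negP => /relabel_arcsP[x [y [E _ _]]].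
by have := relabel_shift_neq i x; rewrite E eqxx.
Qed.

Lemma pull_rshift k l (mu : Dpart k) (nu : Dpart l) :
  pull (@rshift k l) (shift_union mu nu) = nu.
Proof.
have ri := @increasing_rshift k l.
apply: Dpart_eqP => -[[i j] a]; rewrite in_pull // in_shift_union mem_relabel_arcs //.
rewrite [X in X || _](_ : _ = false) //; apply/negP => /relabel_arcsP[x [y [E _ _]]].
by have := relabel_shift_neq x i; rewrite E eqxx.
Qed.

Lemma pm_lshiftN k l (x : 'I_((k + l) + (k + l))) :
  x \notin pm (@lshift k l @: setT) -> exists y, x = relabel (@rshift k l) y.
Proof.
have H (i : 'I_(k + l)) : i \notin @lshift k l @: setT -> exists j, i = rshift k j.
  by case: (split_ordP i) => j ->; [rewrite imset_f|exists j].
have [i [->|->]] := ord_pmP x; rewrite ?pm_neg pm_lshift => /H[j ->].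
  by exists (lshift l j); rewrite relabel_pos.
by exists (rev_ord (lshift l j)); rewrite relabel_neg relabel_pos.
Qed.

Lemma pm_rshift k l (A : {set 'I_k}) (B : {set 'I_l}) y :
  (relabel (@rshift k l) y \in pm (@lshift k l @: A :|: @rshift k l @: B)) = (y \in pm B).
Proof.
rewrite pmU pm_relabel; last exact: increasing_rshift.
rewrite [X in X || _](_ : _ = false) //; apply/negP => /pm_imset[x E _].
by have := relabel_shift_neq x y; rewrite E eqxx.
Qed.

Lemma pm_lshiftU k l (A : {set 'I_k}) (B : {set 'I_l}) x :
  (relabel (@lshift k l) x \in pm (@lshift k l @: A :|: @rshift k l @: B)) = (x \in pm A).
Proof.
rewrite pmU pm_relabel // [X in _ || X](_ : _ = false) ?orbF //.
apply/negP => /pm_imset[y E _].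
by have := relabel_shift_neq x y; rewrite E eqxx.
Qed.

Lemma splits_shift_union k l (mu : Dpart k) (nu : Dpart l)
    (A : {set 'I_k}) (B : {set 'I_l}) :
  splits (@lshift k l @: A :|: @rshift k l @: B) (shift_union mu nu)
    = splits A mu && splits B nu.
Proof.
apply/splitsP/andP => [H|[/splitsP sA /splitsP sB] i j a].
  split; apply/splitsP => x y a xya.
    rewrite -(pm_lshiftU A B x) -(pm_lshiftU A B y); apply: (H _ _ a).
    by rewrite in_shift_union mem_relabel_arcs ?xya.
  rewrite -(pm_rshift A B x) -(pm_rshift A B y); apply: (H _ _ a).
  by rewrite in_shift_union [X in _ || X]mem_relabel_arcs ?xya ?orbT //; exact: increasing_rshift.
rewrite in_shift_union => /orP[]/relabel_arcsP[x [y [-> -> xya]]].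
  by rewrite !pm_lshiftU; exact: sA xya.
by rewrite !pm_rshift; exact: sB xya.
Qed.

Lemma splits_lshift k l (mu : Dpart k) (nu : Dpart l) :
  splits (@lshift k l @: setT) (shift_union mu nu).
Proof.
have := splits_shift_union mu nu setT set0; rewrite imset0 setU0 => ->.
by rewrite splitsT splits0.
Qed.

(** Reduces equalities between shifted unions to equalities of the pullbacks to the blocks. *)
Lemma shift_union_pull k l (X : Dpart (k + l)) : splits (@lshift k l @: setT) X ->
  shift_union (pull (@lshift k l) X) (pull (@rshift k l) X) = X.
Proof.
have ri := @increasing_rshift k l.
move=> /splitsP sX; apply: Dpart_eqP => -[[i j] a]; rewrite in_shift_union.
apply/orP/idP => [[]/relabel_arcsP[x [y [-> ->]]]|H]; rewrite ?in_pull //.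
have := sX _ _ _ H; case: (boolP (i \in _)) => [iL /esym jL|iR /esym/negbT jR].
  have [x Ex _] := pm_imset iL; have [y Ey _] := pm_imset jL.
  by left; rewrite Ex Ey mem_relabel_arcs // in_pull // -Ex -Ey.
have [x Ex] := pm_lshiftN iR; have [y Ey] := pm_lshiftN jR.
by right; rewrite Ex Ey mem_relabel_arcs // in_pull // -Ex -Ey.
Qed.

Definition dmul (b c : dpart) : dpart :=
  Tagged Dpart (shift_union (tagged b) (tagged c)).

Definition dunit : dpart := Tagged Dpart (Dpart0 F 0).

(** Transport along an equality of sizes is invisible in [dpart], so elements of different formal
    size can be compared in one size. *)
Lemma Tagged_pull_cast m n (E : m = n) (l : Dpart n) :
  Tagged Dpart (pull (cast_ord E) l) = Tagged Dpart l.
Proof.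
case: n / E l => l; rewrite (_ : cast_ord _ = id) ?pull_id //.
by apply: functional_extensionality_dep => i; exact: cast_ord_id.
Qed.

Lemma increasing_cast m n (E : m = n) : increasing (cast_ord E).
Proof. by []. Qed.

Lemma Dpart0_eq (l : Dpart 0) : l = Dpart0 F 0.
Proof. by apply: Dpart_eqP => -[[[]]]. Qed.

(** After a transport to size [k + l + m], the left side is cut into its three blocks, and the
    pullbacks to them are [la], [mu] and [nu]. *)
Lemma dmulA : associative dmul.
Proof.
move=> [k la] [l mu] [m nu]; rewrite /dmul /=.
set X := shift_union la _; pose E : (k + l + m = k + (l + m))%N := esym (addnA k l m).
rewrite -[LHS](Tagged_pull_cast E); congr Tagged.
have ci := increasing_cast E.
have rl := @increasing_rshift (k + l) m; have r1 := @increasing_rshift k l.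
have r2 := @increasing_rshift k (l + m); have r3 := @increasing_rshift l m.
(* Under the cast, the embeddings of the three blocks for the two bracketings agree. *)
have c1 : cast_ord E \o (lshift m \o lshift l) = @lshift k (l + m).
  by apply: functional_extensionality_dep => i; exact: val_inj.
have c2 : cast_ord E \o (lshift m \o @rshift k l) = @rshift k (l + m) \o @lshift l m.
  by apply: functional_extensionality_dep => i; exact: val_inj.
have c3 : cast_ord E \o @rshift (k + l) m = @rshift k (l + m) \o @rshift l m.
  by apply: functional_extensionality_dep => i; apply: val_inj; rewrite /= addnA.
have i1 := increasing_comp (@increasing_lshift (k + l) m) (@increasing_lshift k l).
have i2 := increasing_comp (@increasing_lshift (k + l) m) r1.
have sX1 := splits_lshift la (shift_union mu nu).
have sX2 := splits_shift_union la (shift_union mu nu) setT (@lshift l m @: setT).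
rewrite splitsT splits_lshift /= in sX2.
rewrite -[LHS]shift_union_pull; last first.
  apply/splitsP => x y a; rewrite in_pull // => H.
  have eqR z : (relabel (cast_ord E) z \in
      pm (@lshift k (l + m) @: setT :|: @rshift k (l + m) @: (@lshift l m @: setT)))
      = (z \in pm (@lshift (k + l) m @: setT)).
    rewrite -(pm_relabel _ _ ci); congr (_ \in pm _); apply/setP => i.
    rewrite -!imset_comp; apply/setUP/imsetP => [[]/imsetP[j _ ->]|[j _ ->]].
    - by exists (lshift l j) => //; exact: val_inj.
    - by exists (rshift k j) => //; exact: val_inj.
    case: (split_ordP j) => j' ->; [left|right]; apply/imsetP; exists j' => //;
      exact: val_inj.
  by rewrite -(eqR x) -(eqR y); exact: (splitsP _ _ sX2 _ _ _ H).
have -> : pull (@rshift (k + l) m) (pull (cast_ord E) X) = nu.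
  by rewrite pull_comp // c3 -pull_comp // !pull_rshift.
congr shift_union; set Y := pull _ _.
rewrite -[LHS]shift_union_pull; last first.
  apply/splitsP => x y a; rewrite !in_pull // => H.
  have := splitsP _ _ sX1 _ _ _ H.
  have eqR z : (relabel (cast_ord E) (relabel (lshift m) z) \in pm (@lshift k (l + m) @: setT))
      = (z \in pm (@lshift k l @: setT)).
    rewrite relabel_comp -(pm_relabel _ _ (increasing_comp ci (@increasing_lshift (k + l) m))).
    congr (_ \in pm _); rewrite -imset_comp; apply: eq_imset => i; exact: val_inj.
  by rewrite !eqR.
congr shift_union.
  by rewrite /Y !pull_comp // c1 pull_lshift.
rewrite /Y !pull_comp //.
by rewrite c2 -pull_comp // pull_rshift pull_lshift.
Qed.

Lemma dmul1 : left_id dunit dmul.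
Proof.
(* [0 + n] is convertible to [n], so this side needs no transport; [n + 0] on the other side
   does. *)
move=> [n l]; rewrite /dmul /=; congr (Tagged Dpart (_ : Dpart n)).
rewrite -[RHS](@shift_union_pull 0 n) ?[pull (@lshift 0 n) l]Dpart0_eq.
  have r0 : @rshift 0 n = id by apply: functional_extensionality_dep => i; exact: val_inj.
  by rewrite r0 pull_id.
have E0 (x : 'I_(n + n)) : (x \in pm (@lshift 0 n @: setT)) = false.
  by have [i [->|->]] := ord_pmP x; rewrite ?pm_neg pm_lshift; apply/imsetP => -[[]].
by apply/splitsP => x y a _; rewrite !E0.
Qed.

Lemma dmulr1 : right_id dunit dmul.
Proof.
move=> [n l]; rewrite /dmul /= -[RHS](Tagged_pull_cast (addn0 n)); congr Tagged.
rewrite -[RHS](@shift_union_pull n 0) ?[pull (@rshift n 0) _]Dpart0_eq.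
  congr shift_union; rewrite pull_comp // (_ : _ \o _ = id) ?pull_id //.
  by apply: functional_extensionality_dep => i; exact: val_inj.
have E1 (x : 'I_((n + 0) + (n + 0))) : x \in pm (@lshift n 0 @: setT).
  by have [i [->|->]] := ord_pmP x; rewrite ?pm_neg pm_lshift;
     case: (split_ordP i) => [j ->|[] //]; rewrite imset_f.
by apply/splitsP => x y a _; rewrite !E1.
Qed.

(** Gluing the increasing enumerations of [A] and [B] gives the map [h] that enumerates their
    shifted union; on each block, pulling back along [h] is standardizing [mu] or [nu]. *)
Lemma restriction_shift_union k l (mu : Dpart k) (nu : Dpart l)
    (A : {set 'I_k}) (B : {set 'I_l}) :
  restriction (shift_union mu nu) (@lshift k l @: A :|: @rshift k l @: B)
    = dmul (restriction mu A) (restriction nu B).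
Proof.
have [f [fi EA]] := increasing_exists A; have [g [gi EB]] := increasing_exists B.
pose h (x : 'I_(#|A| + #|B|)) : 'I_(k + l) :=
  match split x with inl i => lshift l (f i) | inr j => rshift k (g j) end.
have hl : h \o lshift #|B| = lshift l \o f.
  by apply: functional_extensionality_dep => i; rewrite /h /= (unsplitK (inl i)).
have hr : h \o @rshift #|A| #|B| = @rshift k l \o g.
  by apply: functional_extensionality_dep => i; rewrite /h /= (unsplitK (inr i)).
have hlE i : h (lshift #|B| i) = lshift l (f i) by exact: (congr1 (fun u => u i) hl).
have hrE i : h (rshift #|A| i) = rshift k (g i) by exact: (congr1 (fun u => u i) hr).
have hi : increasing h.
  move=> x y; case: (split_ordP x) => i ->; case: (split_ordP y) => j ->;
    rewrite ?(hlE, hrE) /=.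
  - exact: fi.
  - by have := ltn_ord (f i); lia.
  - by move=> /ltnW/(leq_trans (leq_addr _ _)); rewrite leqNgt ltn_ord.
  - by rewrite !ltn_add2l; exact: gi.
have Eh : @lshift k l @: A :|: @rshift k l @: B = h @: setT.
  rewrite [in LHS]EA [in LHS]EB -!imset_comp.
  apply/setP => x; apply/setUP/imsetP => [[]/imsetP[i _ ->]|[i _ ->]].
  - by exists (lshift #|B| i); rewrite ?hlE.
  - by exists (rshift #|A| i); rewrite ?hrE.
  by case: (split_ordP i) => j ->; [left; rewrite hlE|right; rewrite hrE];
    apply/imsetP; exists j.
rewrite Eh restriction_pull // /dmul /=; congr Tagged.
have li := @increasing_lshift #|A| #|B|; have ri := @increasing_rshift #|A| #|B|.
have ri' := @increasing_rshift k l.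
rewrite -[LHS]shift_union_pull.
  rewrite !pull_comp // hl hr -(@pull_comp F _ _ _ (lshift l) f) //.
  rewrite -(@pull_comp F _ _ _ (@rshift k l) g) // pull_lshift pull_rshift.
  by rewrite (std_pull _ fi EA) (std_pull _ gi EB).
have E z : (relabel h z \in pm (@lshift k l @: setT)) = (z \in pm (@lshift #|A| #|B| @: setT)).
  have [i [->|->]] := ord_pmP z; rewrite ?relabel_neg ?relabel_pos ?pm_neg !pm_lshift;
  case: (split_ordP i) => j ->; rewrite ?(hlE, hrE) ?imset_f //;
  by apply/imsetP/imsetP => -[u _ /eqP]; rewrite eq_sym ?eq_lrshift.
by apply/splitsP => x y a; rewrite in_pull // => /(splitsP _ _ (splits_lshift mu nu)); rewrite !E.
Qed.

(** Subsets of the union are pairs of subsets, with complements and splitting taken componentwise.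
    This is the multiplicativity of the coproduct on the basis. *)
Lemma sum_splits_shift_union (M : zmodType) k l (mu : Dpart k) (nu : Dpart l)
    (phi : dpart -> dpart -> M) :
  \sum_(A | splits A (shift_union mu nu))
     phi (restriction (shift_union mu nu) A) (restriction (shift_union mu nu) (~: A))
  = \sum_(A | splits A mu) \sum_(B | splits B nu)
     phi (dmul (restriction mu A) (restriction nu B))
         (dmul (restriction mu (~: A)) (restriction nu (~: B))).
Proof.
pose join (p : {set 'I_k} * {set 'I_l}) := @lshift k l @: p.1 :|: @rshift k l @: p.2.
have in_l A B i : (lshift l i \in join (A, B)) = (i \in A).
  rewrite in_setU mem_imset; last exact: lshift_inj.
  by rewrite orbC; case: imsetP => // -[j _ /eqP]; rewrite eq_lrshift.
have in_r A B i : (rshift k i \in join (A, B)) = (i \in B).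
  rewrite in_setU [X in _ || X]mem_imset; last exact: rshift_inj.
  by case: imsetP => // -[j _ /eqP]; rewrite eq_sym eq_lrshift.
rewrite pair_big_dep /=.
rewrite (reindex_onto join (fun A => (@lshift k l @^-1: A, @rshift k l @^-1: A))) /=.
  apply: eq_big => [[A B]|[A B] _].
    rewrite splits_shift_union /= (_ : _ == _) ?andbT //.
    by apply/eqP; congr pair; apply/setP => i; rewrite inE ?in_l ?in_r.
  rewrite -!restriction_shift_union; congr (phi _ (restriction _ _)).
  by apply/setP => x; rewrite inE; case: (split_ordP x) => i ->;
    rewrite ?in_l ?in_r -/(join (~: A, ~: B)) ?in_l ?in_r inE.
move=> A _; apply/setP => x; case: (split_ordP x) => i ->; by rewrite ?in_l ?in_r inE.
Qed.

End ShiftUnion.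
(** * The Hopf algebra *)

Section TensorMaps.
Variable K : fieldType.

Lemma linear_comp (U V W : lmodType K) (f : V -> W) (g : U -> V) :
  linear f -> linear g -> linear (fun x => f (g x)).
Proof. by move=> fL gL a x y; rewrite gL fL. Qed.

Lemma linear_is_linear (U V : lmodType K) (f : {linear U -> V}) : linear f.
Proof. by move=> a x y; rewrite linearP. Qed.

Definition linear_of (U V : lmodType K) (f : U -> V) (fL : linear f) : {linear U -> V} :=
  HB.pack f (GRing.isLinear.Build K U V _ f fL).

Variables V W : lmodType K.

Lemma tens_linearl (w : W) : linear (fun v : V => v \otimes w).
Proof. exact: (tens_bilin V W).1. Qed.

Lemma tens_linearr (v : V) : linear (fun w : W => v \otimes w).
Proof. exact: (tens_bilin V W).2. Qed.

Lemma tensor_ind (Q : tensor V W -> Prop) :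
  (forall a s t, Q s -> Q t -> Q (a *: s + t)) -> Q 0 ->
  (forall v w, Q (v \otimes w)) -> forall t, Q t.
Proof.
move=> QL Q0 Qt t; rewrite -[t]tensor_reprK; set x := (X in tensor_proj X).
have projL : linear (@tensor_proj K V W).
  by move=> a y z; rewrite tensor_projD tensor_projZ.
rewrite -[x]freeg_sumE (linear_fun_sum projL).
elim/big_ind: _ => // [s u Qs Qu|p _]; first by rewrite -[s]scale1r; exact: QL.
have -> : << coeff p x *g p >> = coeff p x *: << p >> :> {freeg (V * W)%type / K}.
  by apply/eqP/freeg_eqP => z; rewrite [RHS]coeff_fgscale !coeffU mul1r.
by rewrite (linear_funZ projL) -[_ *: _]addr0; apply: QL => //; case: p => v w; exact: Qt.
Qed.

Lemma tensor_ext (M : lmodType K) (f g : tensor V W -> M) : linear f -> linear g ->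
  (forall v w, f (v \otimes w) = g (v \otimes w)) -> f =1 g.
Proof.
move=> fL gL fg; apply: tensor_ind => [a s t fs ft||//]; first by rewrite fL gL fs ft.
by rewrite !linear_fun0.
Qed.

Lemma tlift_sum (M : lmodType K) (f : V -> W -> M) I r (P : pred I) v w :
  bilin f -> tlift f (\sum_(i <- r | P i) v i \otimes w i)
    = \sum_(i <- r | P i) f (v i) (w i).
Proof.
move=> fb; rewrite (linear_fun_sum (tlift_linear fb)).
by apply: eq_bigr => i _; rewrite tlift_tens.
Qed.

(** For lifts whose bilinear map depends on an outer variable, as in [tassoc] and [tmul]. *)
Lemma tlift_param_linear (U M : lmodType K) (f : U -> V -> W -> M) t :
  (forall u, bilin (f u)) -> (forall v w, linear (fun u => f u v w)) ->
  linear (fun u => tlift (f u) t).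
Proof.
move=> fb fL; elim/tensor_ind: t => [a s t sL tL b x y||v w a x y].
- by rewrite !(tlift_linear (fb _)) sL tL !scalerDr !scalerA addrACA (mulrC a).
- by move=> a x y; rewrite !(linear_fun0 (tlift_linear (fb _))) scaler0 addr0.
- by rewrite !tlift_tens // fL.
Qed.

End TensorMaps.

(** * Product, coproduct, convolution and antipode *)

Section HopfStructure.
Variables (F : finFieldType) (C : fieldType).
Hypothesis two_neq0 : 2%:R != 0 :> F.
Local Notation Dpart := (Dpart F).
Local Notation dpart := (dpart F).
Local Notation SC := (SC F C).
Local Notation dunit := (dunit F).

Definition PB (b : dpart) : SC := Pbasis C (tagged b).

Definition extend (M : lmodType C) (g : dpart -> M) : SC -> M :=
  Pextend two_neq0 (fun n l => g (Tagged Dpart l)).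

Lemma extend_linear (M : lmodType C) (g : dpart -> M) : linear (extend g).
Proof. exact: Pextend_linear. Qed.

Lemma extendP (M : lmodType C) (g : dpart -> M) b : extend g (PB b) = g b.
Proof. by case: b => n l; rewrite /extend PextendP. Qed.

Lemma PB_ext (M : lmodType C) (f g : SC -> M) : linear f -> linear g ->
  (forall b, f (PB b) = g (PB b)) -> f =1 g.
Proof.
by move=> fL gL fg; apply: (Pbasis_ext two_neq0) => // n l; exact: (fg (Tagged Dpart l)).
Qed.

Definition scmul (x y : SC) : SC :=
  extend (fun b => extend (fun c => PB (dmul b c)) y) x.

(** Linearity in [y] is not immediate, since [y] sits inside the function being extended; it is
    checked for [x] in the basis. *)
Lemma scmul_bilin : bilin scmul.
Proof.
have sl y : linear (scmul^~ y) by exact: extend_linear.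
split=> //; apply: (SC_ind two_neq0) => [a f g fL gL b x y||n l b x y].
- by rewrite !(sl _ a) fL gL !scalerDr !scalerA addrACA (mulrC a).
- by move=> a x y; rewrite !(linear_fun0 (sl _)) scaler0 addr0.
- by rewrite /scmul !(extendP _ (Tagged Dpart l)) extend_linear.
Qed.

Lemma scmul_linearl y : linear (scmul^~ y). Proof. exact: scmul_bilin.1. Qed.
Lemma scmul_linearr x : linear (scmul x). Proof. exact: scmul_bilin.2. Qed.

Lemma scmulP b c : scmul (PB b) (PB c) = PB (dmul b c).
Proof. by rewrite /scmul !extendP. Qed.

Lemma scmulA : associative scmul.
Proof.
move=> x y z; move: x; apply: PB_ext => [||b].
- exact: scmul_linearl.
- by apply: linear_comp; exact: scmul_linearl.
move: y; apply: PB_ext => [||c].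
- by apply: linear_comp; [exact: scmul_linearr|exact: scmul_linearl].
- by apply: linear_comp; [exact: scmul_linearl|exact: scmul_linearr].
move: z; apply: PB_ext => [||d].
- by apply: linear_comp; exact: scmul_linearr.
- exact: scmul_linearr.
by rewrite !scmulP dmulA.
Qed.

Lemma sconeE : scone F C = PB dunit.
Proof.
rewrite /scone /PB /Pbasis /=; congr scinj.
rewrite (bigD1 (Dpart0 F 0)) //= big1 ?addr0 // => l /andP[_].
by rewrite (Dpart0_eq l) eqxx.
Qed.

Lemma dunitE b : tag b = 0%N -> b = dunit.
Proof. by case: b => [[|n] l] //= _; rewrite (Dpart0_eq l). Qed.

Lemma scmul1 : left_id (scone F C) scmul.
Proof.
apply: PB_ext => [||b]; [exact: scmul_linearr|by []|].
by rewrite sconeE scmulP dmul1.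
Qed.

Lemma scmulr1 : right_id (scone F C) scmul.
Proof.
apply: PB_ext => [||b]; [exact: scmul_linearl|by []|].
by rewrite sconeE scmulP dmulr1.
Qed.

Definition dcomul (b : dpart) : tensor SC SC :=
  \sum_(A | splits A (tagged b))
    PB (restriction (tagged b) A) \otimes PB (restriction (tagged b) (~: A)).

Definition sccomul : SC -> tensor SC SC := extend dcomul.

Lemma sccomul_linear : linear sccomul. Proof. exact: extend_linear. Qed.

Lemma sccomulP b : sccomul (PB b) = dcomul b. Proof. exact: extendP. Qed.

Lemma restrictionT n (l : Dpart n) : restriction l setT = Tagged Dpart l.
Proof.
have -> : setT = id @: setT :> {set 'I_n} by rewrite imset_id.
by rewrite restriction_pull // pull_id.
Qed.

Lemma sccounitP b : sccounit (PB b) = (tag b == 0%N)%:R.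
Proof.
case: b => [[|n] l]; rewrite /PB /sccounit /Pbasis; last by rewrite scinj_out ?ffunE.
rewrite scinj_in (bigD1 l) // big1 => [|mu /andP[_]]; last first.
  by rewrite (Dpart0_eq mu) (Dpart0_eq l) eqxx.
rewrite /= addr0 (_ : UDone F 0 = rep two_neq0 l) ?kappa_rep ?eqxx //.
by apply: val_inj; apply/matrixP => -[].
Qed.

(* The unit of the convolution algebra, in the basis. *)
Definition dcounit (b : dpart) : SC := (tag b == 0%N)%:R *: scone F C.

(** The convolution of linear endomorphisms of [SC], each represented by its values on the [P]s. *)
Definition conv (f g : dpart -> SC) (b : dpart) : SC :=
  \sum_(A | splits A (tagged b))
    scmul (f (restriction (tagged b) A)) (g (restriction (tagged b) (~: A))).

Lemma scmul_suml I r (P : pred I) (f : I -> SC) y :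
  scmul (\sum_(i <- r | P i) f i) y = \sum_(i <- r | P i) scmul (f i) y.
Proof. exact: (linear_fun_sum (scmul_linearl y)). Qed.

Lemma scmul_sumr I r (P : pred I) (f : I -> SC) x :
  scmul x (\sum_(i <- r | P i) f i) = \sum_(i <- r | P i) scmul x (f i).
Proof. exact: (linear_fun_sum (scmul_linearr x)). Qed.

Lemma convA : associative conv.
Proof.
move=> f g h; apply: functional_extensionality_dep => -[n l]; rewrite /conv /=.
under [RHS]eq_bigr do rewrite scmul_suml.
rewrite [RHS](sum_splits_assoc l (fun b c d => scmul (scmul (f b) (g c)) (h d))).
apply: eq_bigr => A _; rewrite scmul_sumr.
by apply: eq_bigr => B _; rewrite scmulA.
Qed.

Lemma conv1 : left_id dcounit conv.
Proof.
move=> f; apply: functional_extensionality_dep => -[n l]; rewrite /conv /=.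
rewrite (bigD1 set0) ?splits0 //= big1 => [|A /andP[_ A0]].
  by rewrite setC0 restrictionT /dcounit /= cards0 eqxx scale1r scmul1 addr0.
rewrite /dcounit /= cards_eq0 (negbTE A0) scale0r.
by rewrite (linear_fun0 (scmul_linearl _)).
Qed.

Definition unital (f : dpart -> SC) : Prop := forall b, tag b = 0%N -> f b = scone F C.

(** The term of [A = setT] in [conv g f] is [g b], as [f] is 1 in degree 0; all other terms involve
    [g] only in smaller degree, so the equation determines [g] recursively. *)
Lemma conv_left_inverse f : unital f -> exists2 g, unital g & conv g f = dcounit.
Proof.
move=> fU; have [|g g' [n l] gg'|g gE] := @measure_fixpoint dpart SC (fun b => tag b)
  (fun g b => dcounit b - \sum_(A | splits A (tagged b) && (A != setT))
     scmul (g (restriction (tagged b) A)) (f (restriction (tagged b) (~: A)))).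
- by split; exact: 0.
- congr (_ - _); apply: eq_bigr => A /andP[_ AT]; rewrite gg' //=.
  rewrite -[X in (_ < X)%N]card_ord -cardsT; apply: proper_card.
  by rewrite properEneq AT subsetT.
exists g => [[[|n] l] //= _|].
  rewrite gE /dcounit scale1r big1 ?subr0 // => A /andP[_ /negP[]].
  by apply/eqP/setP => -[].
apply: functional_extensionality_dep => -[n l]; rewrite /conv /=.
rewrite (bigD1 setT) ?splitsT //= restrictionT gE /= setCT.
by rewrite fU /= ?cards0 // scmulr1 subrK.
Qed.

Lemma PB_unital : unital PB.
Proof. by move=> b /dunitE->; rewrite sconeE. Qed.

Lemma dantipode_exists : exists S, conv S PB = dcounit /\ conv PB S = dcounit.
Proof.
have [S SU SP] := conv_left_inverse PB_unital.
have [T _ TS] := conv_left_inverse SU.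
exists S; split=> //; suff <- : T = PB by [].
apply: etrans (conv1 PB); rewrite -TS -convA SP.
apply: functional_extensionality_dep => -[n l]; rewrite /conv /=.
rewrite (bigD1 setT) ?splitsT //= big1 => [|A /andP[_ AT]].
  by rewrite restrictionT setCT /dcounit /= cards0 eqxx scale1r scmulr1 addr0.
rewrite /dcounit /= cards_eq0 (negbTE (_ : ~: A != set0)) ?scale0r.
  by rewrite (linear_fun0 (scmul_linearr _)).
by apply: contra AT => /eqP E; rewrite -[A]setCK E setC0.
Qed.

Definition mul_lin : {linear tensor SC SC -> SC} := linear_of (tlift_linear scmul_bilin).
Definition comul_lin : {linear SC -> tensor SC SC} := linear_of sccomul_linear.

Lemma mul_linE x y : mul_lin (x \otimes y) = scmul x y.
Proof. exact: tlift_tens scmul_bilin. Qed.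

Lemma comul_linP b : comul_lin (PB b) = dcomul b.
Proof. exact: sccomulP. Qed.

Lemma mul_lin_Pproduct : is_Pproduct mul_lin.
Proof.
move=> k l mu nu; rewrite mul_linE.
exact: (scmulP (Tagged Dpart mu) (Tagged Dpart nu)).
Qed.

Lemma Pproduct_unique m : is_Pproduct m -> m =1 mul_lin.
Proof.
move=> mP; apply: tensor_ext => [||x y]; try exact: linear_is_linear.
move: x; apply: PB_ext => [||b].
- by apply: linear_comp; [exact: linear_is_linear|exact: tens_linearl].
- by apply: linear_comp; [exact: linear_is_linear|exact: tens_linearl].
move: y; apply: PB_ext => [||c].
- by apply: linear_comp; [exact: linear_is_linear|exact: tens_linearr].
- by apply: linear_comp; [exact: linear_is_linear|exact: tens_linearr].
by rewrite /PB mP mul_lin_Pproduct.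
Qed.

Lemma comul_lin_Pcoproduct : is_Pcoproduct comul_lin.
Proof. by move=> n l; exact: (sccomulP (Tagged Dpart l)). Qed.

Lemma Pcoproduct_unique D : is_Pcoproduct D -> D =1 comul_lin.
Proof.
move=> DP; apply: PB_ext => [||[n l]]; try exact: linear_is_linear.
by rewrite /PB DP comul_lin_Pcoproduct.
Qed.

Lemma tlift_comul (M : lmodType C) (f : SC -> SC -> M) b : bilin f ->
  tlift f (comul_lin (PB b)) = \sum_(A | splits A (tagged b))
    f (PB (restriction (tagged b) A)) (PB (restriction (tagged b) (~: A))).
Proof. by move=> fb; rewrite comul_linP tlift_sum. Qed.

Lemma comul_lin_linear : linear comul_lin. Proof. exact: linear_is_linear. Qed.

Lemma bilin_comp (U V W U' V' : lmodType C) (f : U -> V -> W) g h :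
  bilin f -> linear (g : U' -> U) -> linear (h : V' -> V) ->
  bilin (fun u v => f (g u) (h v)).
Proof. by move=> [fl fr] gL hL; split=> [w|v] a x y; rewrite ?gL ?hL ?fl ?fr. Qed.

Lemma id_linear (U : lmodType C) : linear (@id U). Proof. by []. Qed.

(** Apart from the bilinearity of the lifted maps, this is [sum_splits_assoc] applied to triple
    tensors of basis elements. *)
Lemma comulA x : tassoc (tmap comul_lin id (comul_lin x)) = tmap id comul_lin (comul_lin x).
Proof.
have tb := @tens_bilin C.
have assoc_bilin (w : SC) : bilin (fun u v : SC => u \otimes (v \otimes w)).
  apply: (bilin_comp (f := fun u t => u \otimes t) (g := id)); [exact: tb|by []|].
  exact: tens_linearl.
have tassoc_bilin : bilin (fun (s : tensor SC SC) (w : SC) =>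
    tlift (fun u v => u \otimes (v \otimes w)) s).
  split=> [w|s]; first exact: tlift_linear.
  apply: tlift_param_linear => // u v.
  by apply: linear_comp; exact: tens_linearr.
have b1 : bilin (fun v w : SC => comul_lin v \otimes w).
  by apply: bilin_comp; [exact: tb|exact: comul_lin_linear|].
have b2 : bilin (fun v w : SC => v \otimes comul_lin w).
  by apply: bilin_comp; [exact: tb| |exact: comul_lin_linear].
move: x; apply: PB_ext => [||[n l]].
- apply: linear_comp; first exact: tlift_linear.
  by apply: linear_comp; [exact: tlift_linear|exact: comul_lin_linear].
- by apply: linear_comp; [exact: tlift_linear|exact: comul_lin_linear].
rewrite [in LHS]/tmap !tlift_comul //=.
rewrite /tassoc (linear_fun_sum (tlift_linear tassoc_bilin)).
under eq_bigr => A _.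
  rewrite tlift_tens // tlift_comul //=; over.
rewrite (sum_splits_assoc l (fun b c d => PB b \otimes (PB c \otimes PB d))).
rewrite /tmap tlift_comul //; apply: eq_bigr => A _.
by rewrite [sccomul _]sccomulP (linear_fun_sum (tens_linearr _)).
Qed.

Lemma counit_linear : linear (@sccounit F C).
Proof. exact: sccounit_linear. Qed.

Lemma counit_bilinl : bilin (fun x y : SC => (sccounit x : C) *: y).
Proof.
split=> [w|v] a x y; first by rewrite sccounit_linear scalerDl scalerA.
by rewrite scalerDr !scalerA mulrC.
Qed.

Lemma counit_bilinr : bilin (fun x y : SC => (sccounit y : C) *: x).
Proof.
split=> [w|v] a x y; last by rewrite sccounit_linear scalerDl scalerA.
by rewrite scalerDr !scalerA mulrC.
Qed.

Lemma scbialgebra : is_bialgebra mul_lin (scone F C) comul_lin (@sccounit F C).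
Proof.
have m_linear : linear mul_lin by exact: linear_is_linear.
split.
- by move=> a b c; rewrite !mul_linE scmulA.
- by move=> a; rewrite mul_linE scmul1.
- by move=> a; rewrite mul_linE scmulr1.
- exact: comulA.
- apply: PB_ext => [||[n l]] //.
    by apply: linear_comp; [exact: tlift_linear counit_bilinl|exact: comul_lin_linear].
  (* The counit kills every left factor of positive degree, so only the empty [A] survives; for the
     right counit only [A = setT] does. *)
  rewrite (tlift_comul _ counit_bilinl) (bigD1 set0) ?splits0 //= big1 => [|A /andP[_ A0]].
    by rewrite setC0 restrictionT sccounitP /= cards0 scale1r addr0.
  by rewrite sccounitP /= cards_eq0 (negbTE A0) scale0r.
- apply: PB_ext => [||[n l]] //.
    by apply: linear_comp; [exact: tlift_linear counit_bilinr|exact: comul_lin_linear].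
  rewrite (tlift_comul _ counit_bilinr) (bigD1 setT) ?splitsT //= big1 => [|A /andP[_ AT]].
    by rewrite setCT restrictionT sccounitP /= cards0 scale1r addr0.
  rewrite sccounitP /= cards_eq0 (negbTE (_ : ~: A != set0)) ?scale0r //.
  by apply: contra AT => /eqP E; rewrite -[A]setCK E setC0.
- have bb (a b : SC) : bilin (fun c d => mul_lin (a \otimes c) \otimes mul_lin (b \otimes d)).
    by apply: bilin_comp; [exact: tens_bilin|..];
      apply: (linear_comp m_linear); exact: tens_linearr.
  have mb t : bilin (fun a b => tlift
      (fun c d => mul_lin (a \otimes c) \otimes mul_lin (b \otimes d)) t).
    split=> [b|a]; apply: tlift_param_linear => // c d.
      apply: (linear_comp (tens_linearl _)); apply: (linear_comp m_linear).
      exact: tens_linearl.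
    apply: (linear_comp (tens_linearr _)); apply: (linear_comp m_linear).
    exact: tens_linearl.
  move=> a b.
  move: a; apply: PB_ext => [||[k mu]].
  + apply: (linear_comp comul_lin_linear); apply: (linear_comp m_linear).
    exact: tens_linearl.
  + by apply: linear_comp comul_lin_linear; exact: tlift_linear (mb _).
  move: b; apply: PB_ext => [||[l nu]].
  + apply: (linear_comp comul_lin_linear); apply: (linear_comp m_linear).
    exact: tens_linearr.
  + rewrite /tmul => c x y; rewrite !tlift_comul //.
    rewrite scaler_sumr -big_split; apply: eq_bigr => A _ /=.
    by rewrite sccomul_linear (tlift_linear (bb _ _)).
  rewrite /tmul tlift_comul // mul_linE scmulP comul_linP /dcomul.
  rewrite (sum_splits_shift_union mu nu (fun b c => PB b \otimes PB c)).
  apply: eq_bigr => A _; rewrite tlift_comul //; apply: eq_bigr => B _.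
  by rewrite !mul_linE !scmulP.
- rewrite sconeE comul_linP /dcomul.
  rewrite (bigD1 setT) ?splitsT //= big1 => [|A /andP[_ /negP[]]]; last first.
    by apply/eqP/setP => -[].
  by rewrite addr0 restrictionT (_ : ~: setT = setT) ?restrictionT //; apply/setP => -[].
- move=> a b.
  move: a; apply: PB_ext => [||c].
  + apply: (linear_comp counit_linear); apply: (linear_comp m_linear).
    exact: tens_linearl.
  + by move=> k x y /=; rewrite sccounit_linear mulrDl -mulrA.
  move: b; apply: PB_ext => [||d].
  + apply: (linear_comp counit_linear); apply: (linear_comp m_linear).
    exact: tens_linearr.
  + by move=> k x y /=; rewrite sccounit_linear mulrDr mulrCA.
  (* Sizes add up under the product, and a sum of sizes is 0 only if both are. *)
  by rewrite mul_linE scmulP /= !sccounitP /= addn_eq0 -natrM mulnb.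
- by rewrite sconeE /= sccounitP.
Qed.

Lemma schopf : is_hopf mul_lin (scone F C) comul_lin (@sccounit F C).
Proof.
split; first exact: scbialgebra.
have [s [sP Ps]] := dantipode_exists.
exists (linear_of (extend_linear s)).
have SE b : linear_of (extend_linear s) (PB b) = s b by exact: extendP.
set S := linear_of _ in SE *.
have m_linear : linear mul_lin by exact: linear_is_linear.
have SL : linear S by exact: linear_is_linear.
have eL : linear (fun a : SC => (sccounit a : C) *: scone F C).
  by move=> k x y; rewrite sccounit_linear scalerDl scalerA.
have tb := @tens_bilin C SC SC.
have bl : bilin (fun x y => mul_lin (S x \otimes y)).
  have [h1 h2] := bilin_comp tb SL (@id_linear _).
  by split=> w; apply: (linear_comp m_linear).
have br : bilin (fun x y => mul_lin (x \otimes S y)).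
  have [h1 h2] := bilin_comp tb (@id_linear _) SL.
  by split=> w; apply: (linear_comp m_linear).
move=> a; split.
  move: a; apply: PB_ext
    => [||b] //; first by apply: linear_comp comul_lin_linear; exact: tlift_linear.
  (* On a basis element the antipode identity is the convolution identity for [s]. *)
  transitivity (dcounit b); last by rewrite /= sccounitP.
  rewrite tlift_comul // -sP.
  by apply: eq_bigr => A _; rewrite mul_linE SE.
move: a; apply: PB_ext
  => [||b] //; first by apply: linear_comp comul_lin_linear; exact: tlift_linear.
transitivity (dcounit b); last by rewrite /= sccounitP.
  rewrite tlift_comul // -Ps.
by apply: eq_bigr => A _; rewrite mul_linE SE.
Qed.

End HopfStructure.
(** The additive order of 1 divides the cardinal of [F]. If 2 were 0 it would also divide 2, hence
    be 1, so that [1 = 0]. *)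
Lemma odd_card_two_neq0 (F : finFieldType) : odd #|F| -> 2%:R != 0 :> F.
Proof.
move=> oddF; apply/eqP => two0; have : (#[1%R : F]%g %| gcdn 2 #|F|)%N.
  rewrite dvdn_gcd order_dvdn FinRing.zmodXgE -mulr_natl two0 mul0r eqxx.
  by rewrite -cardsT order_dvdG ?inE.
rewrite (eqP (_ : coprime 2 #|F|)) ?coprime2n // dvdn1 order_eq1 => /eqP one0.
by case/eqP: (oner_neq0 F).
Qed.

Theorem theorem3p14 (R : realType) (F : finFieldType) (p r : nat)
    (p_prime : prime p) (p_ge3 : (3 <= p)%N) (card_F : #|F| = (p ^ r)%N) :
  exists (m : {linear tensor (SC F R[i]) (SC F R[i]) -> SC F R[i]})
         (Delta : {linear SC F R[i] -> tensor (SC F R[i]) (SC F R[i])}),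
    [/\ is_Pproduct m /\ (forall m', is_Pproduct m' -> m' =1 m),
        is_Pcoproduct Delta /\
          (forall Delta', is_Pcoproduct Delta' -> Delta' =1 Delta)
      & is_hopf m (scone F R[i]) Delta (@sccounit F R[i])].
Proof.
(* A prime [p >= 3] is odd, hence so is [p ^ r]. *)
have two_neq0 : 2%:R != 0 :> F.
  apply: odd_card_two_neq0; rewrite card_F oddX; apply/orP; right.
  by apply: contraLR p_ge3 => /(prime_oddPn p_prime) ->.
exists (mul_lin R[i] two_neq0), (comul_lin R[i] two_neq0); split.
- by split; [exact: mul_lin_Pproduct|exact: Pproduct_unique].
- by split; [exact: comul_lin_Pcoproduct|exact: Pcoproduct_unique].
exact: schopf.
Qed.
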